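(* For each $\lambda\in\Lambda$ choose an arbitrary word $w_\lambda\in\mathfrak{p}^{-1}(\lambda)$. Then the set $\{u_{w_\lambda}\mid\lambda\in\Lambda\}$ is a $\mathbb{Q}(r,s)$-basis of $H_{r,s}(A_\infty)$. Moreover, if all the words $w_\lambda$ are chosen to be distinguished, then this set is a $\mathbb{Z}[r,s]_{(r-1,s-1)}$-basis of $H_{r,s}(A_\infty)_{\mathbb{Z}[r,s]_{(r-1,s-1)}}$.
   Context: $\mathbb{Q}(r,s)$ is the field of rational functions in two independent variables $r,s$; $\mathbb{Z}[r,s]_{(r-1,s-1)}$ is the localization of $\mathbb{Z}[r,s]$ at the prime ideal $(r-1,s-1)$. $A_\infty$ is the quiver $1\to2\to3\to\cdots$ with vertex set $I$; $S_i$ is the simple representation at $i$; $M_{ij}$ ($i\le j$) is the indecomposable with top $S_i$ and composition factors $S_i,\dots,S_j$, corresponding to the positive root $\alpha_i+\dots+\alpha_j$; $\Phi^+$ is the set of these roots. $\Lambda$ is the set of finitely supported maps $\lambda:\Phi^+\to\mathbb{Z}_{\ge0}$; over any field $k$ the finite dimensional representations up to isomorphism are $M_k(\lambda)=\bigoplus_{\beta\in\Phi^+}\lambda(\beta)M_k(\beta)$, $\lambda\in\Lambda$. $H_{r,s}(A_\infty)$ is the $\mathbb{Q}(r,s)$-algebra with basis $\{u_\lambda\mid\lambda\in\Lambda\}$ and product $u_\alpha u_\beta=\sum_\lambda s^{-\langle\alpha,\beta\rangle}F^\lambda_{\alpha\beta}(rs^{-1})u_\lambda$, where $\langle\alpha,\beta\rangle=\dim_k\mathrm{Hom}(M_k(\alpha),M_k(\beta))-\dim_k\mathrm{Ext}^1(M_k(\alpha),M_k(\beta))$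 and $F^\lambda_{\alpha\beta}(x)\in\mathbb{Z}[x]$ is the Hall polynomial: for each finite field $k$ with $q$ elements, $F^\lambda_{\alpha\beta}(q)$ is the number of subrepresentations $N\subseteq M_k(\lambda)$ with $N\cong M_k(\beta)$ and $M_k(\lambda)/N\cong M_k(\alpha)$. $H_{r,s}(A_\infty)_{\mathbb{Z}[r,s]_{(r-1,s-1)}}$ is the $\mathbb{Z}[r,s]_{(r-1,s-1)}$-form of $H_{r,s}(A_\infty)$, i.e. the free $\mathbb{Z}[r,s]_{(r-1,s-1)}$-submodule with basis $\{u_\lambda\mid\lambda\in\Lambda\}$ (a subring). Generic extensions: over an algebraically closed field $k$, for finite dimensional representations $M,N$ there is a unique (up to isomorphism) extension $0\to N\to G\to M\to0$ whose orbit $\mathcal{O}_G$ in the representation variety $R(\mathbf d)$, $\mathbf d=\underline{\dim}M+\underline{\dim}N$, has maximal dimension (equivalently, with $\dim\mathrm{End}(G)$ minimal); write $G=M*N$. The operation $*$ is associative on isomorphism classes. $\Omega$ is the set of all (finite, possibly empty) words in letters from $I$. For $w=i_1\cdots i_m\in\Omega$, $\mathfrak{p}(w)\in\Lambda$ is determined by $S_{i_1}*S_{i_2}*\cdots*S_{i_m}\cong M_k(\mathfrak{p}(w))$ (independent of $k$), and $u_w=u_{i_1}u_{i_2}\cdots u_{i_m}$ where $u_i$ is the basis element of $S_i$. Write $w=j_1^{e_1}\cdots j_t^{e_t}$ with $e_p\ge1$, $j_p\ne j_{p+1}$. A reduced filtration of type $w$ of $M$ is a chain $0=M_t\subset M_{t-1}\subset\cdots\subset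 M_0=M$ of subrepresentations with $M_{p-1}/M_p\cong e_pS_{j_p}$ (direct sum of $e_p$ copies of $S_{j_p}$). The word $w$ is distinguished if over every finite field $k$ the number of reduced filtrations of type $w$ of $M_k(\mathfrak{p}(w))$ is $1$ (equivalently, $M_k(\mathfrak{p}(w))$ has a unique reduced filtration of type $w$ for some algebraically closed $k$). *)

(* Defs.v *)
From mathcomp Require Import all_boot all_order all_algebra.
From mathcomp Require Import finmap multiset monalg.
From mathcomp Require Import boolp classical_sets functions cardinality fsbigop.

Set Implicit Arguments.
Unset Strict Implicit.
Unset Printing Implicit Defensive.

Import GRing.Theory.

Local Open Scope classical_set_scope.
Local Open Scope card_scope.
Local Open Scope ring_scope.

(* The vertex [i : nat] stands for the vertex [i + 1] of A_oo.  The space at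
   [i] is the space of row vectors ['rV_(rdim i)], and the arrow [i -> i.+1]
   acts by [v |-> v *m rmap i]. *)

Record rep (k : fieldType) := Rep {
  rdim : nat -> nat;
  rmap : forall i, 'M[k]_(rdim i, rdim i.+1);
  rfin : exists n, forall i, (n <= i)%N -> rdim i = 0%N
}.

Section Representations.
Variable k : fieldType.
Implicit Types M N X Y G : rep k.

Definition fam (p q : nat -> nat) := forall i, 'M[k]_(p i, q i).

Definition is_hom M N (f : fam (rdim M) (rdim N)) : Prop :=
  forall i, rmap M i *m f i.+1 = f i *m rmap N i.

Definition rep_iso M N : Prop :=
  exists2 f : fam (rdim M) (rdim N), is_hom f &
    forall i, row_free (f i) && row_full (f i).

(* exactness of 0 -> N -> G -> M -> 0 *)
Definition short_exact N G M (f : fam (rdim N) (rdim G))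
    (g : fam (rdim G) (rdim M)) : Prop :=
  [/\ is_hom f, is_hom g &
      forall i, [/\ row_free (f i), row_full (g i) & (f i == kermx (g i))%MS]].

Fact rep0_fin : exists n, forall i, (n <= i)%N -> (fun=> 0%N) i = 0%N.
Proof. by exists 0%N. Qed.

Definition rep0 : rep k := @Rep k (fun=> 0%N) (fun=> 0) rep0_fin.

Fact rep_add_fin M N :
  exists n, forall i, (n <= i)%N -> (rdim M i + rdim N i)%N = 0%N.
Proof.
have [m hm] := rfin M; have [n hn] := rfin N; exists (maxn m n) => i.
by rewrite geq_max => /andP[/hm -> /hn ->].
Qed.

Definition rep_add M N : rep k :=
  @Rep k (fun i => rdim M i + rdim N i)%N
    (fun i => block_mx (rmap M i) 0 0 (rmap N i)) (rep_add_fin M N).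

(* [has_dim P eqv n]: the linear subspace [P] of [fam p q], taken modulo the
   (linear) equivalence relation [eqv], has a basis with [n] elements. *)

Definition has_dim p q (P : set (fam p q)) (eqv : fam p q -> fam p q -> Prop)
    (n : nat) : Prop :=
  exists2 b : 'I_n -> fam p q, (forall j, P (b j)) &
    forall f, P f -> exists! c : 'rV[k]_n,
      eqv f (fun i => \sum_j c 0 j *: b j i).

Definition hom_dim M N : nat :=
  xget 0%N [set n | has_dim [set f : fam (rdim M) (rdim N) | is_hom f]
                            (fun f g => forall i, f i = g i) n].

(* Every extension of [M] by [N] is equivalent to one of the extensions
   [ext_rep c] of [M] by [N] with underlying spaces the [N_i (+) M_i], and the
   addition and scaling of the parameter [c] induce the Baer sum and the scalar
   multiplication of Ext^1. *)
Definition ext_fam M N := fam (rdim M) (fun i => rdim N i.+1).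

Definition ext_rep M N (c : ext_fam M N) : rep k :=
  @Rep k (fun i => rdim N i + rdim M i)%N
    (fun i => block_mx (rmap N i) 0 (c i) (rmap M i)) (rep_add_fin N M).

(* Yoneda equivalence of extensions: an isomorphism of the middle terms that is
   compatible with the inclusions of [N] and the projections to [M]. *)
Definition ext_equiv M N (c c' : ext_fam M N) : Prop :=
  exists f : fam (rdim (ext_rep c)) (rdim (ext_rep c')),
    [/\ is_hom f,
        forall i, row_free (f i) && row_full (f i),
        forall i (x : 'rV_(rdim N i)), row_mx x 0 *m f i = row_mx x 0 &
        forall i (x : 'rV_(rdim N i + rdim M i)),
          rsubmx (x *m f i) = rsubmx x].

Definition ext1_dim M N : nat :=
  xget 0%N [set n | has_dim [set: ext_fam M N] (@ext_equiv M N) n].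

Definition subfam M := forall i, {vspace 'rV[k]_(rdim M i)}.

Definition subfam0 M : subfam M := fun=> 0%VS.
Definition subfamT M : subfam M := fun=> fullv.

Definition is_subrep M (U : subfam M) : Prop :=
  forall i v, v \in U i -> v *m rmap M i \in U i.+1.

Definition subfam_le M (U V : subfam M) : Prop := forall i, (U i <= V i)%VS.

(* [V / U ~= Y] for subrepresentations [U] of [V] of [M]: there is a surjective
   homomorphism [V -> Y] with kernel [U].  Only the restriction of [g i] to
   [V i] matters. *)
Definition subquo_iso M (V U : subfam M) Y : Prop :=
  exists g : fam (rdim M) (rdim Y),
    [/\ forall i v, v \in V i -> v *m rmap M i *m g i.+1 = v *m g i *m rmap Y i,
        forall i y, exists2 v, v \in V i & v *m g i = y &
        forall i v, v \in V i -> (v *m g i = 0 <-> v \in U i)].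

(* [G] is [M * N]; over an algebraically closed field. *)
Definition generic_ext M N G : Prop :=
  (exists f g, @short_exact N G M f g) /\
  (forall G', (exists f g, @short_exact N G' M f g) ->
     (hom_dim G G <= hom_dim G' G')%N).

End Representations.

(* the pair [(i, j)] with [i <= j] is the root alpha_i + ... + alpha_j *)
Definition root := {p : nat * nat | (p.1 <= p.2)%N}.

Definition simple_root (i : nat) : root :=
  exist (fun p : nat * nat => (p.1 <= p.2)%N) (i, i) (leqnn i).

(* [{mset root}] is [{fsfun root -> nat with 0}] *)
Definition Lam := {mset root}%mset.

Section Indecomposables.
Variable k : fieldType.

Definition root_dim (b : root) (x : nat) : nat :=
  ((val b).1 <= x <= (val b).2)%N.

Fact root_dim_fin b : exists n, forall x, (n <= x)%N -> root_dim b x = 0%N.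
Proof.
exists (val b).2.+1 => x lt_bx.
by rewrite /root_dim [(x <= _)%N]leqNgt lt_bx andbF.
Qed.

(* The dimensions are 0 or 1; the map is the identity of [k] whenever both
   ends of the arrow lie in the support. *)
Definition rep_root (b : root) : rep k :=
  @Rep k (root_dim b) (fun x => const_mx 1) (root_dim_fin b).

Definition rep_sum (s : seq root) : rep k :=
  foldr (fun b => rep_add (rep_root b)) (rep0 k) s.

(* [enum_mset l] lists each root [b] with multiplicity [l b] *)
Definition rep_Lam (l : Lam) : rep k := rep_sum (enum_mset l).

End Indecomposables.

Definition hall_set (k : fieldType) (a b l : Lam) : set (subfam (rep_Lam k l)) :=
  [set U | [/\ is_subrep U,
               subquo_iso U (@subfam0 k _) (rep_Lam k b) &
               subquo_iso (@subfamT k _) U (rep_Lam k a)]].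

Arguments hall_set : clear implicits.

(* [F^l_{a b}]: the unique integer polynomial whose value at the order of each
   finite field is the Hall number. *)
Definition hall_poly (a b l : Lam) : {poly int} :=
  xget 0 [set P : {poly int} | forall k : finFieldType,
    exists2 n : nat, hall_set k a b l #= `I_n & P.[#|k|%:R] = n%:R].

(* <a, b>, which does not depend on the field *)
Definition euler (a b : Lam) : int :=
  xget 0 [set n : int | forall k : fieldType,
    n = (hom_dim (rep_Lam k a) (rep_Lam k b))%:Z
        - (ext1_dim (rep_Lam k a) (rep_Lam k b))%:Z].

(* Z[r, s] as Z[r][s] *)
Notation Zrs := {poly {poly int}}.
Definition pr : Zrs := 'X%:P.
Definition ps : Zrs := 'X.

(* the fraction field of Z[r, s], i.e. Q(r, s) *)
Notation Qrs := {fraction Zrs}.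
Definition rr : Qrs := FracField.tofrac pr.
Definition ss : Qrs := FracField.tofrac ps.

(* the free module on [Lam]; [u_l] is [<< l >>] *)
Notation Hall := {malg Qrs[Lam]}.

Definition hall_basis (l : Lam) : Hall := << l >>.

Definition hall_mul_basis (a b : Lam) : Hall :=
  \sum_(l \in [set: Lam])
    (ss ^ (- euler a b) * (map_poly intr (hall_poly a b l)).[rr / ss])
      *: hall_basis l.

Definition hall_mul (x y : Hall) : Hall :=
  \sum_(a <- msupp x) \sum_(b <- msupp y)
    (x@_a * y@_b) *: hall_mul_basis a b.

Definition word := seq nat.

(* [u_w]; the unit of the algebra is the basis element of the zero
   representation. *)
Definition u_word (w : word) : Hall :=
  foldr (fun i => hall_mul (hall_basis [mset simple_root i]%mset))
        (hall_basis mset0) w.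

(* [G ~= S_{i_1} * (S_{i_2} * (... * S_{i_m}))] for [w = i_1 ... i_m] *)
Fixpoint is_word_ext (k : fieldType) (w : word) (G : rep k) : Prop :=
  if w is i :: w' then
    exists2 N, is_word_ext w' N & generic_ext (rep_root k (simple_root i)) N G
  else rep_iso G (rep0 k).

(* the graph of the map p from words to [Lam] *)
Definition word_class (w : word) (l : Lam) : Prop :=
  forall k : closedFieldType, is_word_ext w (rep_Lam k l).

(* run-length encoding: [j_1^{e_1} ... j_t^{e_t}] with [j_p != j_{p+1}] and
   [e_p >= 1] is sent to [(j_1, e_1) ... (j_t, e_t)] *)
Fixpoint rle (w : word) : seq (nat * nat) :=
  if w is i :: w' then
    if rle w' is (j, e) :: s then
      if i == j then (j, e.+1) :: s else [:: (i, 1%N), (j, e) & s]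
    else [:: (i, 1%N)]
  else [::].

Fact rleK (w : word) : flatten [seq nseq p.2 p.1 | p <- rle w] = w.
Proof.
elim: w => //= i w; case: (rle w) => [|[j e] s] /= <- //.
by case: eqVneq => [->|].
Qed.

Fact rle_gt0 (w : word) : all (fun p => 0 < p.2)%N (rle w).
Proof.
elim: w => //= i w; case: (rle w) => [|[j e] s] //= /andP[e0 s0].
by case: ifP => _ /=; rewrite ?e0 s0.
Qed.

Fact rle_neq (w : word) : sorted (fun p q => p.1 != q.1) (rle w).
Proof.
elim: w => //= i w; case: (rle w) => [|[j e] s] //= hs.
by case: eqVneq => [_|/= ->] //; case: s hs.
Qed.

(* chains [M = F 0 > F 1 > ... > F t = 0] *)
Definition reduced_filtrations (k : fieldType) (w : word) (M : rep k) :
    set ('I_(size (rle w)).+1 -> subfam M) :=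
  [set F | [/\ F ord0 = @subfamT k M,
               F ord_max = @subfam0 k M,
               forall p, is_subrep (F p) &
               forall p : 'I_(size (rle w)),
                 let V := F (widen_ord (leqnSn _) p) in
                 let U := F (lift ord0 p) in
                 let je := nth (0%N, 0%N) (rle w) p in
                 subfam_le U V /\
                 subquo_iso V U
                   (rep_sum k (nseq je.2 (simple_root je.1)))]].

Arguments reduced_filtrations : clear implicits.

Definition distinguished (w : word) : Prop :=
  exists2 l, word_class w l &
    forall k : finFieldType, reduced_filtrations k w (rep_Lam k l) #= `I_1.

(* the localization of Z[r, s] at the prime ideal (r - 1, s - 1) *)
Definition in_ideal_rs1 (q : Zrs) : Prop :=
  exists a b : Zrs, q = a * (pr - 1) + b * (ps - 1).

Definition Zrs_loc : set Qrs :=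
  [set x | exists p q : Zrs, ~ in_ideal_rs1 q /\
             x = FracField.tofrac p / FracField.tofrac q].

(* the S-span of the [u_l]; for [S] the localization it is the integral form *)
Definition Hall_form (S : set Qrs) : set Hall :=
  [set x | forall l : Lam, S (x@_l)].

(* The family [v] is a basis over the subring [S] of the [S]-submodule [L]. *)
Definition is_basis_over (S : set Qrs) (L : set Hall) (v : Lam -> Hall) : Prop :=
  let comb (c : Hall) := \sum_(l <- msupp c) c@_l *: v l in
  [/\ forall l, L (v l),
      forall x, L x -> exists2 c, (forall l, S (c@_l)) & x = comb c &
      forall c, (forall l, S (c@_l)) -> comb c = 0 -> c = 0].

(* Main.v *)
(* A representation is determined by the ranks of its maps [M a -> M b].  An
   extension of [S_i] by [N] adds one vector at [i], and its ranks exceed those of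
   [N] by [1] exactly at the pairs [(i, b)] with [b <= c], for some [c >= i]; the
   generic extension is the one with [c] maximal, because enlarging [c] strictly
   lowers the dimension of the endomorphism algebra.

   The subrepresentations of M(l) with quotient [S_i] that are isomorphic to M(m)
   are the hyperplanes of M(l)_i that contain a certain subspace but not a certain
   larger one, so the Hall polynomial is
   [x^e + ... + x^(t-1)], where [t - e > 0] is the multiplicity of the root [i..c]
   in [l].  At [r = s = 1] its value is a positive integer.  By induction, [u_w] is
   a combination of the [u_l] with [l] below [p(w)] in the order of ranks; each
   nonzero coefficient is positive at [r = s = 1], and the one at [p(w)] is not
   zero.  Positive integers are invertible in the localization at the prime ideal
   [(r - 1, s - 1)], whose residue field is Q, so the transition matrix is triangular
   with invertible diagonal over the localization as well. *)

Require Import Defs.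
From mathcomp Require Import all_boot all_order all_algebra.
From mathcomp Require Import boolp classical_sets.
From mathcomp Require Import zify algC mxabelem.
From mathcomp Require Import finmap multiset monalg cardinality fsbigop.

Set Implicit Arguments.
Unset Strict Implicit.
Unset Printing Implicit Defensive.
Import Order.TTheory GRing.Theory Num.Theory.
Local Open Scope ring_scope.

(** * Composite maps along paths, isomorphisms of representations, and ranks *)

Section Representations.
Variable k : fieldType.
Implicit Types M N Y G : rep k.

(** The dependent update replaces a cast: the identity of [M a] has to be typed as a map
    [M a -> M b]. *)
Definition at_vertex M m (a : nat) (v : 'M[k]_(m, rdim M a)) :
    forall b, 'M[k]_(m, rdim M b) :=
  eqtype.dfwith (fun b => 0 : 'M[k]_(m, rdim M b)) v.

Lemma at_vertex_in M m a (v : 'M[k]_(m, rdim M a)) : at_vertex v a = v.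
Proof. exact: eqtype.dfwith_in. Qed.

Lemma at_vertex_out M m a (v : 'M[k]_(m, rdim M a)) b :
  a != b -> at_vertex v b = 0.
Proof. exact: eqtype.dfwith_out. Qed.

(* The composite [M a -> M b] of the arrows; junk value [0] if [b < a]. *)
Fixpoint path_mx M (a b : nat) : 'M[k]_(rdim M a, rdim M b) :=
  if b is b'.+1 then path_mx M a b' *m rmap M b' + at_vertex 1%:M b'.+1
  else at_vertex 1%:M 0.

Lemma path_mx_lt M a b : (b < a)%N -> path_mx M a b = 0.
Proof.
elim: b => [|b IHb] lt_ba /=; first by rewrite at_vertex_out ?gtn_eqF.
by rewrite IHb 1?ltnW // mul0mx add0r at_vertex_out ?gtn_eqF.
Qed.

Lemma path_mxx M a : path_mx M a a = 1%:M.
Proof.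
case: a => [|a] /=; first by rewrite at_vertex_in.
by rewrite path_mx_lt // mul0mx add0r at_vertex_in.
Qed.

Lemma path_mxSr M a b : (a <= b)%N -> path_mx M a b.+1 = path_mx M a b *m rmap M b.
Proof. by move=> le_ab /=; rewrite at_vertex_out ?ltn_eqF ?addr0. Qed.

Lemma path_mxSl M a b : (a < b)%N -> path_mx M a b = rmap M a *m path_mx M a.+1 b.
Proof.
elim: b => // b IHb; rewrite ltnS leq_eqVlt => /orP[/eqP <- | lt_ab].
  by rewrite path_mxSr // !path_mxx mul1mx mulmx1.
by rewrite !path_mxSr ?(ltnW lt_ab) // IHb // mulmxA.
Qed.

Lemma path_mxD M a b c : (a <= b <= c)%N ->
  path_mx M a c = path_mx M a b *m path_mx M b c.
Proof.
elim: c => [|c IHc].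
  by rewrite leqn0 => /andP[+ /eqP b0]; rewrite b0 => ?; rewrite path_mxx mulmx1.
case/andP=> le_ab; rewrite leq_eqVlt => /orP[/eqP <- | ].
  by rewrite path_mxx mulmx1.
rewrite ltnS => le_bc; rewrite !path_mxSr ?(leq_trans le_ab) //.
by rewrite IHc ?le_ab // mulmxA.
Qed.

Lemma path_mx_hom M N (f : fam k (rdim M) (rdim N)) a b : is_hom f -> (a <= b)%N ->
  path_mx M a b *m f b = f a *m path_mx N a b.
Proof.
move=> hf; elim: b => [|b IHb]; first by rewrite leqn0 => /eqP->; rewrite !path_mxx mul1mx mulmx1.
rewrite leq_eqVlt => /orP[/eqP <- | ].
  by rewrite !path_mxx mul1mx mulmx1.
by rewrite ltnS => le_ab; rewrite !path_mxSr // -mulmxA hf !mulmxA IHb.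
Qed.

Lemma is_hom_mul M N Y (f : fam k (rdim M) (rdim N)) (g : fam k (rdim N) (rdim Y)) :
  is_hom f -> is_hom g -> is_hom (fun i => f i *m g i).
Proof. by move=> hf hg i; rewrite mulmxA hf -!mulmxA hg. Qed.

(* [f] need not be presented by square matrices, so invertibility is stated
   through a two-sided inverse. *)
Lemma rep_isoP M N :
  rep_iso M N <-> exists (f : fam k (rdim M) (rdim N)) (g : fam k (rdim N) (rdim M)),
    [/\ is_hom f, is_hom g, forall i, f i *m g i = 1%:M & forall i, g i *m f i = 1%:M].
Proof.
split=> [[f hf f_bij] | [f [g [hf _ fg gf]]]]; last first.
  exists f => // i; apply/andP; split; first by apply/row_freeP; exists (g i).
  by apply/row_fullP; exists (g i).
have fK i : f i *m pinvmx (f i) = 1%:M by have /andP[? _] := f_bij i; rewrite mulmxVp.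
have fVK i : pinvmx (f i) *m f i = 1%:M by have /andP[_ ?] := f_bij i; rewrite mulVpmx.
exists f, (fun i => pinvmx (f i)); split=> // i.
by rewrite -[LHS]mul1mx -(fVK i) -mulmxA (mulmxA (f i)) -hf -!mulmxA fK mulmx1.
Qed.

Lemma rep_iso_refl M : rep_iso M M.
Proof.
by apply/rep_isoP; exists (fun=> 1%:M), (fun=> 1%:M); split=> i; rewrite !(mulmx1, mul1mx).
Qed.

Lemma rep_iso_sym M N : rep_iso M N -> rep_iso N M.
Proof. by move/rep_isoP=> [f [g [hf hg fg gf]]]; apply/rep_isoP; exists g, f. Qed.

Lemma rep_iso_trans N M Y : rep_iso M N -> rep_iso N Y -> rep_iso M Y.
Proof.
move=> /rep_isoP[f [g [hf hg fg gf]]] /rep_isoP[f' [g' [hf' hg' fg' gf']]].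
apply/rep_isoP; exists (fun i => f i *m f' i), (fun i => g' i *m g i).
split; [exact: is_hom_mul | exact: is_hom_mul | |] => i.
  by rewrite mulmxA -(mulmxA (f i)) fg' mulmx1.
by rewrite mulmxA -(mulmxA (g' i)) gf mulmx1.
Qed.

Lemma rep_iso_addr M N N' : rep_iso N N' -> rep_iso (rep_add M N) (rep_add M N').
Proof.
move=> /rep_isoP[f [g [hf hg fg gf]]]; apply/rep_isoP.
exists (fun i => block_mx 1%:M 0 0 (f i)), (fun i => block_mx 1%:M 0 0 (g i)).
by split=> i; rewrite /= !mulmx_block !(mulmx0, mul0mx, mulmx1, mul1mx, addr0, add0r)
  ?hf ?hg ?fg ?gf -?scalar_mx_block.
Qed.

Lemma rep_iso_addCA A B C :
  rep_iso (rep_add A (rep_add B C)) (rep_add B (rep_add A C) : rep k).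
Proof.
(* One formula serves for every triple, so the inverse of the swap is the swap with [X] and [Y]
   exchanged. *)
pose f (X Y Z : rep k) : fam k (rdim (rep_add X (rep_add Y Z))) (rdim (rep_add Y (rep_add X Z))) :=
  fun i => block_mx 0 (row_mx 1%:M 0) (col_mx 1%:M 0) (block_mx 0 0 0 1%:M).
have fh X Y Z : is_hom (f X Y Z).
  move=> i; rewrite /f /= !mulmx_block.
  rewrite !(mulmx0, mul0mx, mulmx1, mul1mx, addr0, add0r, mul_mx_row, mul_row_block,
    mul_block_col, mul_col_mx, mulmx_block).
  by [].
have fK X Y Z i : f X Y Z i *m f Y X Z i = 1%:M.
  rewrite /f /= !mulmx_block.
  rewrite !(mulmx0, mul0mx, mulmx1, mul1mx, addr0, add0r, mul_mx_row, mul_row_block,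
    mul_block_col, mul_col_mx, mulmx_block, mul_row_col, mul_col_row, row_mx0, col_mx0).
  rewrite -[X in row_mx _ X + _]col_mx0 -block_mxEh add_block_mx !addr0 !add0r.
  by rewrite -!scalar_mx_block.
by apply/rep_isoP; exists (f A B C), (f B A C).
Qed.

Lemma rep_iso_perm (s t : seq Defs.root) : perm_eq s t -> rep_iso (rep_sum k s) (rep_sum k t).
Proof.
elim: s t => [|b s IHs] t st.
  by move: (perm_size st); case: t st => // *; apply: rep_iso_refl.
have bt : b \in t by rewrite -(perm_mem st) mem_head.
apply: (@rep_iso_trans (rep_sum k (b :: rem b t))).
  apply: rep_iso_addr; apply: IHs.
  by rewrite -(perm_cons b) (permPl st) perm_to_rem.
elim: t bt {st IHs} => //= c t IHt; rewrite in_cons [c == b]eq_sym.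
case: eqP => [-> _ | _ /= /IHt ct]; first exact: rep_iso_refl.
exact: rep_iso_trans (rep_iso_addCA _ _ _) (rep_iso_addr _ ct).
Qed.

Lemma rank_path_iso M N a b : rep_iso M N -> (a <= b)%N ->
  \rank (path_mx M a b) = \rank (path_mx N a b).
Proof.
move=> [f hf f_bij] le_ab.
have /andP[fb _] := f_bij b; have /andP[_ fa] := f_bij a.
by rewrite -(mxrankMfree _ fb) (path_mx_hom hf) // (eqmxMfull _ fa).
Qed.

Lemma path_mx_add M N a b : (a <= b)%N ->
  path_mx (rep_add M N) a b = block_mx (path_mx M a b) 0 0 (path_mx N a b).
Proof.
elim: b => [|b IHb]; first by rewrite leqn0 => /eqP->; rewrite !path_mxx -scalar_mx_block.
rewrite leq_eqVlt => /orP[/eqP <- | ].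
  by rewrite !path_mxx -scalar_mx_block.
rewrite ltnS => le_ab; rewrite !path_mxSr // IHb //= mulmx_block.
by rewrite !(mulmx0, mul0mx, addr0, add0r).
Qed.

Lemma rank_const1_bool (b c : bool) : \rank (const_mx 1 : 'M[k]_(b, c)) = b && c.
Proof.
case: b c => [] [] /=; try by apply/eqP; rewrite -leqn0 ?(rank_leq_row, rank_leq_col).
by rewrite -[X in \rank X]/(const_mx 1) [const_mx 1]mx11_scalar mxE mxrank1.
Qed.

(** An entry exists only if [a] and [b] lie in the support; then so do all vertices between them,
    and every factor is the scalar [1]. Otherwise the matrix is empty. *)
Lemma path_mx_root (r : Defs.root) a b : (a <= b)%N -> path_mx (rep_root k r) a b = const_mx 1.
Proof.
elim: b => [|b IHb].
  rewrite leqn0 => /eqP->; rewrite path_mxx; apply/matrixP=> i j; rewrite !mxE.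
  move: i j => /=; rewrite /root_dim; case: (_ && _) => /= i; last by case: i.
  by move=> j; rewrite !ord1.
rewrite leq_eqVlt => /orP[/eqP <- | ].
  rewrite path_mxx; apply/matrixP=> i j; rewrite !mxE.
  move: i j => /=; rewrite /root_dim; case: (_ && _) => /= i; last by case: i.
  by move=> j; rewrite !ord1.
rewrite ltnS => le_ab; rewrite path_mxSr // IHb //=; apply/matrixP=> i j; rewrite !mxE.
under eq_bigr do rewrite !mxE mulr1.
rewrite sumr_const card_ord; have := leq_ltn_trans (leq0n i) (ltn_ord i).
have := leq_ltn_trans (leq0n j) (ltn_ord j); rewrite /= /root_dim !lt0b.
move=> /andP[_ br] /andP[ra _].
by rewrite (leq_trans ra le_ab) (ltnW br).
Qed.

Lemma rank_path_root (r : Defs.root) a b : (a <= b)%N ->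
  \rank (path_mx (rep_root k r) a b) = (((val r).1 <= a) && (b <= (val r).2))%N.
Proof.
move=> le_ab; rewrite path_mx_root // rank_const1_bool.
by case: leqP => //= ra; case: (leqP b) => br;
  rewrite ?andbF // (leq_trans le_ab br) (leq_trans ra le_ab).
Qed.

End Representations.

(** * Classification of representations *)

Section Classification.
Variable k : fieldType.
Implicit Types M N Y G : rep k.

(** Stability of the kernels under the arrows, which makes them a subrepresentation. *)
Definition stable_ker M q (g : fam k (rdim M) q) : Prop :=
  forall i, kermx (g i) *m rmap M i *m g i.+1 = 0.

Lemma hom_stable_ker M N (g : fam k (rdim M) (rdim N)) : is_hom g -> stable_ker g.
Proof. by move=> hg i; rewrite -mulmxA hg mulmxA mulmx_ker mul0mx. Qed.

Fact ker_rep_fin M q (g : fam k (rdim M) q) :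
  exists n, forall i, (n <= i)%N -> \rank (kermx (g i)) = 0%N.
Proof.
have [n hn] := rfin M; exists n => i /hn di; apply/eqP; rewrite -leqn0.
by apply: leq_trans (rank_leq_row _) _; rewrite di.
Qed.

(** The arrows are written in the chosen bases of the kernels; [pinvmx] reads off the
    coordinates. *)
Definition ker_rep M q (g : fam k (rdim M) q) : rep k :=
  Rep (fun i => row_base (kermx (g i)) *m rmap M i *m pinvmx (row_base (kermx (g i.+1))))
    (ker_rep_fin g).

Definition ker_incl M q (g : fam k (rdim M) q) : fam k (rdim (ker_rep g)) (rdim M) :=
  fun i => row_base (kermx (g i)).

Lemma ker_incl_hom M q (g : fam k (rdim M) q) : stable_ker g -> is_hom (ker_incl g).
Proof.
move=> hg i; rewrite /= mulmxKpV // eq_row_base sub_kermx -mulmxA.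
have /submxP[D ->] : (row_base (kermx (g i)) <= kermx (g i))%MS by rewrite eq_row_base.
by rewrite -mulmxA (mulmxA (kermx _)) hg mulmx0.
Qed.

Lemma const_mx1_mul m n p :
  (const_mx 1 : 'M[k]_(m, n)) *m (const_mx 1 : 'M_(n, p)) = const_mx n%:R.
Proof.
apply/matrixP=> i j; rewrite !mxE; under eq_bigr do rewrite !mxE mulr1.
by rewrite sumr_const card_ord.
Qed.

(* If [a] is the first vertex of the support and [b] the last one that a vector
   [v] of [M a] reaches, the subrepresentation generated by [v] is a direct
   summand: a linear form that is [1] on the image of [v] at [b] pulls back to a
   retraction. *)
Lemma split_root M a : rdim M a != 0%N ->
  exists (r : Defs.root) (K : rep k), rep_iso M (rep_add (rep_root k r) K).
Proof.
move=> Ma; have exa : exists a, rdim M a != 0%N by exists a.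
case: (ex_minnP exa) => {Ma exa}a Ma a_min.
have M_lt t : (t < a)%N -> rdim M t = 0%N.
  by move=> lt_ta; apply/eqP; apply: contraLR lt_ta => /a_min; rewrite -leqNgt.
pose P b := (a <= b)%N && (path_mx M a b != 0).
have exb : exists b, P b.
  exists a; rewrite /P leqnn path_mxx -mxrank_eq0 mxrank1; exact: Ma.
have [n hn] := rfin M.
have bnd b : P b -> (b <= n)%N.
  case/andP=> _; apply: contraR; rewrite -ltnNge => /ltnW /hn db.
  by rewrite -mxrank_eq0 -leqn0 -db rank_leq_col.
case: (ex_maxnP exb bnd) => b /andP[le_ab Pab] b_max {exb bnd n hn}.
have dead t : t == b -> path_mx M a t.+1 = 0.
  move/eqP->; apply/eqP; apply: contraT => nz; have /b_max := introT andP (conj (leqW le_ab) nz).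
  by rewrite ltnn.
have [v v_nz] : exists v : 'rV_(rdim M a), v *m path_mx M a b != 0.
  have /rowV0Pn[w /submxP[v ->] nz] : path_mx M a b != 0 by [].
  by exists v.
have /row_freeP[eta v_eta] : row_free (v *m path_mx M a b).
  by rewrite /row_free rank_rV v_nz.
pose r : Defs.root := exist (fun p : nat * nat => (p.1 <= p.2)%N) (a, b) le_ab.
pose g : fam k (rdim M) (rdim (rep_root k r)) :=
  fun t => path_mx M t b *m eta *m const_mx 1.
pose x : fam k (rdim (rep_root k r)) (rdim M) :=
  fun t => const_mx 1 *m (v *m path_mx M a t).
have dim_r t (i : 'I_(rdim (rep_root k r) t)) : (a <= t <= b)%N.
  by have := leq_ltn_trans (leq0n i) (ltn_ord i); rewrite /= /root_dim lt0b.
have dim_r1 t : (a <= t <= b)%N -> rdim (rep_root k r) t = 1%N.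
  by rewrite /= /root_dim /= => ->.
have dim_r1R t : (a <= t <= b)%N -> (rdim (rep_root k r) t)%:R = 1 :> k.
  by move/dim_r1->.
have g_hom : is_hom g.
  move=> t; apply/matrixP=> i j; have /andP[_ lt_tb] := dim_r _ j.
  have le_at : (a <= t)%N.
    by rewrite leqNgt; apply/negP=> /M_lt d0; case: (i) => m; rewrite d0.
  rewrite /g !mulmxA -path_mxSl // -!mulmxA const_mx1_mul.
  by rewrite dim_r1R // le_at ltnW.
have x_hom : is_hom x.
  move=> t; apply/matrixP=> i j; have /andP[le_at le_tb] := dim_r _ i.
  rewrite /x -!mulmxA -path_mxSr //.
  move: le_tb; rewrite leq_eqVlt => /orP[e | lt_tb].
    by rewrite (dead t e) !mulmx0.
  have d1 := dim_r1R t.+1 (introT andP (conj (leqW le_at) lt_tb)).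
  by rewrite mulmxA const_mx1_mul d1.
have xg t : x t *m g t = 1%:M.
  apply/matrixP=> i j; have /andP[le_at le_tb] := dim_r _ i.
  rewrite /x /g -!mulmxA (mulmxA (path_mx _ _ _)) -path_mxD ?le_at //.
  rewrite !mulmxA -(mulmxA _ v) -(mulmxA _ _ eta) v_eta mulmx1 const_mx1_mul !mxE.
  suff -> : i = j by rewrite eqxx.
  case: i j => [m +] [m' +]; move: (dim_r1 t); rewrite le_at => /(_ le_tb).
  by move: (rdim _ t) => _ ->; case: m m' => [|?] [|?] // *; apply: val_inj.
exists r, (ker_rep g); apply: rep_iso_sym.
exists (fun t => col_mx (x t) (ker_incl g t)) => t.
  rewrite [LHS]mul_block_col !mul0mx addr0 add0r mul_col_mx x_hom.
  by rewrite (ker_incl_hom (hom_stable_ker g_hom)).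
(* The identity is [g t *m x t] plus a remainder that [g t] kills, because [x t *m g t] is the
   identity. *)
have full : row_full (col_mx (x t) (ker_incl g t)).
  rewrite -sub1mx -addsmxE; set X := (_ + _)%MS.
  have -> : 1%:M = g t *m x t + (1%:M - g t *m x t) by rewrite addrC subrK.
  apply: addmx_sub.
    exact: submx_trans (submxMl _ _) (addsmxSl _ _).
  apply: submx_trans (addsmxSr _ _).
  by rewrite eq_row_base sub_kermx mulmxBl mul1mx -mulmxA xg mulmx1 subrr.
rewrite full andbT /row_free (eqP full).
rewrite -[X in _ == X]/(rdim (rep_root k r) t + \rank (kermx (g t)))%N mxrank_ker.
have /eqP -> : row_full (g t) by apply/row_fullP; exists (x t).
by rewrite subnKC // -{1}(mxrank1 k (rdim (rep_root k r) t)) -(xg t) mulmx_max_rank.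
Qed.

Lemma rep_iso_rep0 M : (forall i, rdim M i = 0%N) -> rep_iso M (rep0 k).
Proof.
move=> M0; exists (fun i => 0) => i.
  by apply/matrixP=> x; have := leq_ltn_trans (leq0n x) (ltn_ord x); rewrite [X in (0 < X)%N]M0.
by rewrite /row_free /row_full mxrank0 /= M0.
Qed.

(** Splitting off one root lowers the total dimension, so the process ends. *)
Lemma rep_sum_exists M : exists s : seq Defs.root, rep_iso M (rep_sum k s).
Proof.
have [n] := rfin M; move: (leqnn (\sum_(i < n) rdim M i)%N).
move: {2}(\sum_(i < n) rdim M i)%N => m; elim: m M => [|m IHm] M le_m hn.
  exists nil; apply: rep_iso_rep0 => i; case: (leqP n i) => [/hn // | lt_in].
  by move: le_m; rewrite leqn0 sum_nat_eq0 => /forallP/(_ (Ordinal lt_in))/eqP.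
have [M0 | ] := pselect (forall i, rdim M i = 0%N).
  by exists nil; apply: rep_iso_rep0.
move/existsNP=> [a /eqP Ma]; have [r [K isoK]] := split_root Ma.
have dimM i : rdim M i = (root_dim r i + rdim K i)%N.
  have := rank_path_iso isoK (leqnn i); rewrite !path_mxx !mxrank1; exact.
have /IHm : (\sum_(i < n) rdim K i <= m)%N.
  rewrite -ltnS; apply: leq_trans le_m.
  have r1_lt : ((val r).1 < n)%N.
    rewrite ltnNge; apply/negP=> /hn; rewrite dimM /root_dim leqnn.
    by rewrite (valP r).
  under [X in (_ <= X)%N]eq_bigr do rewrite dimM.
  rewrite big_split /= -add1n leq_add2r.
  by rewrite (bigD1 (Ordinal r1_lt)) //= {1}/root_dim leqnn (valP r).
case=> [i /hn | s isoS]; first by rewrite dimM => /eqP; rewrite addn_eq0 => /andP[_ /eqP].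
by exists (r :: s); apply: rep_iso_trans isoK (rep_iso_addr _ isoS).
Qed.

End Classification.

(* Multisets of roots and their rank functions *)
Identity Coercion multiset_of_Lam : Lam >-> multiset_of.

Section RootCounting.
Implicit Types (s : seq Defs.root) (l m : Lam) (r : Defs.root).

(* For [a <= b] this is the rank of the map [M a -> M b] where [M] is the
   direct sum of the indecomposables in [s]. *)
Definition rk s a b : nat :=
  count (fun r => ((val r).1 <= a)%N && (b <= (val r).2)%N) s.

(** The increment of [rk] in its first argument; its own decrement at [b] is the multiplicity of the
    root [i..b]. *)
Definition starts s i b : nat :=
  count (fun r => ((val r).1 == i) && (b <= (val r).2)%N) s.

Definition mk_root i j (le_ij : (i <= j)%N) : Defs.root :=
  exist (fun p : nat * nat => (p.1 <= p.2)%N) (i, j) le_ij.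

Lemma rk_starts s i b :
  rk s i b = (starts s i b + (if i is j.+1 then rk s j b else 0))%N.
Proof.
rewrite /rk /starts; elim: s => [|r s IHs] /=; first by case: (i).
by case: i IHs => [|j] /= ->; case: (_ <= (val r).2)%N; rewrite ?andbF ?andbT //; lia.
Qed.

Lemma starts_count s i c (le_ic : (i <= c)%N) :
  starts s i c = (count_mem (mk_root le_ic) s + starts s i c.+1)%N.
Proof.
rewrite /starts; elim: s => [|[[x y] le_xy] s IHs] //=.
rewrite IHs -val_eqE /= xpair_eqE; case: (x =P i) => //= _; lia.
Qed.

Lemma starts_antitone s i b c : (b <= c)%N -> (starts s i c <= starts s i b)%N.
Proof. by move=> le_bc; apply: sub_count => r /andP[-> /(leq_trans le_bc)]. Qed.

Lemma rk_homo_l s a a' b : (a <= a')%N -> (rk s a b <= rk s a' b)%N.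
Proof. by move=> le_a; apply: sub_count => r /andP[/leq_trans/(_ le_a) -> ->]. Qed.

Lemma rk_perm s t a b : perm_eq s t -> rk s a b = rk t a b.
Proof. by move/permP; apply. Qed.

(** The multiplicity of a root is a mixed second difference of [rk], taken through [starts]. *)
Lemma rk_inj l m : (forall a b, (a <= b)%N -> rk l a b = rk m a b) -> l = m.
Proof.
move=> e; have st i b : (i <= b)%N -> starts l i b = starts m i b.
  move=> le_ib; have := e _ _ le_ib; rewrite !rk_starts.
  by case: i le_ib => [|j] le_ib; rewrite ?addn0 // (e j) 1?ltnW //; apply: addIn.
apply/msetP => -[[i c] le_ic]; rewrite -!count_mem_mset; have := st _ _ le_ic.
by rewrite !(starts_count _ le_ic) st ?leqW //; apply: addIn.
Qed.

(* Over any field, [l] then describes the extensions of the simple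
   representation at [i] by that of [m] in which a new vector at [i] survives
   exactly up to the vertex [c]. *)
Definition covers i c m l : Prop :=
  (i <= c)%N /\
  forall a b, (a <= b)%N -> rk l a b = (rk m a b + ((a == i) && (b <= c)))%N.

Lemma covers_inj i c m l l' : covers i c m l -> covers i c m l' -> l = l'.
Proof. by move=> [_ e] [_ e']; apply: rk_inj => a b le_ab; rewrite e ?e'. Qed.

Lemma covers_le i c c' m l : covers i c m l -> covers i c' m l -> (c <= c')%N.
Proof.
move=> [le_ic e] [_ e']; have := e _ _ le_ic; rewrite e' // => /addnI.
by rewrite eqxx leqnn; case: (c <= c')%N.
Qed.

Lemma covers_starts i c m l b : covers i c m l -> (i <= b)%N ->
  starts l i b = (starts m i b + (b <= c))%N.
Proof.
move=> [_ e] le_ib; have := e _ _ le_ib; rewrite !rk_starts eqxx.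
case: i le_ib e => [|j] le_ib e; first by rewrite !addn0.
by rewrite (e j) ?(ltnW le_ib) // ltn_eqF // addn0 addnAC => /addIn.
Qed.

Lemma covers_starts_lt i c m l : covers i c m l -> (starts l i c.+1 < starts l i c)%N.
Proof.
move=> cov; have [le_ic _] := cov; rewrite !(covers_starts cov) ?leqW //.
by rewrite ltnn leqnn addn0 addn1 ltnS starts_antitone.
Qed.

Lemma covers_mem i c m l (cov : covers i c m l) : mk_root (proj1 cov) \in enum_mset l.
Proof.
have := covers_starts_lt cov; rewrite (starts_count _ (proj1 cov)) -has_pred1 has_count; lia.
Qed.

(** If [c > i], comparing the ranks at [(i, c)] and [(i.+1, c)] yields a root of [m] that reaches
    [c]. Hence only finitely many [c] occur for a given [m]. *)
Lemma covers_bound i c m l : covers i c m l -> (c <= i + \sum_(r <- m) (val r).2)%N.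
Proof.
move=> cov; have [] := cov; rewrite leq_eqVlt => /orP[/eqP-> _ | lt_ic e].
  exact: leq_addr.
have : (0 < rk m i.+1 c)%N.
  have := e _ _ lt_ic; rewrite gtn_eqF // addn0 => <-.
  have := rk_homo_l l c (leqnSn i); rewrite e ?(ltnW lt_ic) // eqxx leqnn; lia.
rewrite -has_count => /hasP[r rm /andP[_ le_cr]].
by apply: leq_trans le_cr (leq_trans _ (leq_addl _ _)); rewrite (big_rem r) //= leq_addr.
Qed.

(** A root of [m] that begins at [i.+1] and reaches [c] is prolonged to the left by the vertex [i];
    [C] is its end. *)
Lemma covers_exists i c m : (i < c)%N -> (0 < starts m i.+1 c)%N ->
  exists C l, (c <= C)%N /\ covers i C m l.
Proof.
move=> lt_ic; rewrite -has_count => /hasP[[[x C] le_xC] rm /= /andP[/eqP ex le_cC]].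
subst x; set r := exist _ _ _ in rm.
exists C, (seq_mset (mk_root (ltnW le_xC) :: rem r m)); split=> //; split=> [|a b le_ab].
  exact: ltnW.
rewrite (rk_perm _ _ (perm_eq_seq_mset _)) /= (rk_perm a b (perm_to_rem rm)) /=.
case: (leqP b C) => le_bC; rewrite ?(andbT, andbF) ?addn0 //=; lia.
Qed.

End RootCounting.

(** * Ranks as a complete invariant of isomorphism classes *)

Section Classes.
Variable k : fieldType.
Implicit Types (M N : rep k) (l m : Lam).

Lemma rank_rep_sum s a b : (a <= b)%N -> \rank (path_mx (rep_sum k s) a b) = rk s a b.
Proof.
move=> le_ab; elim: s => [|r s IHs] /=.
  by apply/eqP; rewrite -leqn0 rank_leq_row.
by rewrite path_mx_add // rank_diag_block_mx IHs rank_path_root.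
Qed.

Lemma rep_iso_LamP M l : rep_iso M (rep_Lam k l) <->
  forall a b, (a <= b)%N -> \rank (path_mx M a b) = rk l a b.
Proof.
split=> [isoM a b le_ab | e]; first by rewrite (rank_path_iso isoM) // rank_rep_sum.
have [s isoM] := rep_sum_exists M.
suff -> : l = seq_mset s.
  apply: rep_iso_trans isoM (rep_iso_perm _ _); rewrite perm_sym; exact: perm_eq_seq_mset.
apply: rk_inj => a b le_ab; rewrite -e // (rank_path_iso isoM) // rank_rep_sum //.
by rewrite (rk_perm _ _ (perm_eq_seq_mset _)).
Qed.

Lemma rep_Lam_exists M : exists l, rep_iso M (rep_Lam k l).
Proof.
have [s isoM] := rep_sum_exists M; exists (seq_mset s).
by apply: rep_iso_trans isoM (rep_iso_perm _ _); rewrite perm_sym; apply: perm_eq_seq_mset.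
Qed.

End Classes.

(** * Extensions of a simple representation *)

Section SimpleQuotients.
Variables (k : fieldType) (T : rep k) (i : nat).
(** [T] is kept abstract because the simple representation appears both as
    [rep_root k (simple_root i)], in generic extensions, and as [rep_Lam k [mset simple_root i]], in
    Hall sets. *)
Hypothesis dim_T : forall a, rdim T a = (a == i).
Implicit Types (M N G : rep k) (l m : Lam).

(** Both sides are the codimension of the intersection of the two kernels. *)
Lemma rank_ker_mul d n e (g : 'M[k]_(d, n)) (P : 'M[k]_(d, e)) :
  (\rank g + \rank (kermx g *m P) = \rank P + \rank (kermx P *m g))%N.
Proof.
have := mxrank_mul_ker (kermx g) P; have := mxrank_mul_ker (kermx P) g.
rewrite capmxC !mxrank_ker; have := rank_leq_row g; have := rank_leq_row P; lia.
Qed.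

(** A column of the cokernel of [A] is the form. The equation [t = 1] is a hypothesis because [t]
    will be [rdim T i]. *)
Lemma exists_form d t p q (A : 'M[k]_(p, d)) (B : 'M[k]_(q, d)) : t = 1%N ->
  ~~ (B <= A)%MS -> exists x : 'M[k]_(d, t), A *m x = 0 /\ B *m x != 0.
Proof.
move=> -> ; rewrite submxE => /matrix0Pn[u [j nz]].
exists (col j (cokermx A)); split; first by rewrite colE mulmxA mulmx_coker mul0mx.
by apply/matrix0Pn; exists u, 0; rewrite colE mulmxA -colE mxE.
Qed.

Lemma short_exact_rank N G Y f g a b : @short_exact k N G Y f g -> (a <= b)%N ->
  \rank (path_mx N a b) = \rank (kermx (g a) *m path_mx G a b).
Proof.
move=> [hf _ ex] le_ab; have [fb _ _] := ex b; have [_ _ /eqmxP fa] := ex a.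
by rewrite -(mxrankMfree _ fb) (path_mx_hom hf) // (eqmxMr _ fa).
Qed.

Lemma ker_rep_exact G Y (g : fam k (rdim G) (rdim Y)) : is_hom g ->
  (forall a, row_full (g a)) -> @short_exact k (ker_rep g) G Y (ker_incl g) g.
Proof.
move=> hg g_full; split=> // [|a]; first exact: ker_incl_hom (hom_stable_ker hg).
by split=> //; [exact: row_base_free | apply/eqmxP/eq_row_base].
Qed.

Lemma short_exact_iso N N' G Y g : rep_iso N' N -> (exists f, @short_exact k N G Y f g) ->
  exists f, @short_exact k N' G Y f g.
Proof.
move=> [h hh h_bij] [f [hf hg ex]]; exists (fun a => h a *m f a).
split=> // [|a]; first exact: is_hom_mul.
have [fa ga /eqmxP eq_f] := ex a; have /andP[h_free h_full] := h_bij a.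
split=> //; first by rewrite /row_free mxrankMfree.
by apply/eqmxP; apply: eqmx_trans eq_f; apply: eqmxMfull.
Qed.

(** The form [x] vanishes on the kernel of [G i -> G b]: a vector on which [x] is nonzero still has
    a nonzero image at [b]. *)
Definition survives G (x : 'M[k]_(rdim G i, rdim T i)) b :=
  kermx (path_mx G i b) *m x == 0.

Lemma survives_antitone G (x : 'M_(rdim G i, rdim T i)) b c :
  (i <= b <= c)%N -> survives x c -> survives x b.
Proof.
move=> ibc /eqP xc0; rewrite /survives.
have /submxP[D ->] : (kermx (path_mx G i b) <= kermx (path_mx G i c))%MS.
  by rewrite sub_kermx (path_mxD _ ibc) mulmxA mulmx_ker mul0mx.
by rewrite -mulmxA xc0 mulmx0.
Qed.

Lemma survives_max G (x : 'M_(rdim G i, rdim T i)) : x != 0 ->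
  exists2 c, (i <= c)%N & forall b, (i <= b)%N -> survives x b = (b <= c)%N.
Proof.
move=> x_nz; pose P b := (i <= b)%N && survives x b.
have exP : exists b, P b.
  by exists i; rewrite /P leqnn /survives path_mxx -[kermx _]mulmx1 mulmx_ker mul0mx eqxx.
have [n hn] := rfin G.
have bndP b : P b -> (b <= n)%N.
  case/andP=> _; apply: contraLR; rewrite -ltnNge => /ltnW /hn db.
  have /eqP P0 : path_mx G i b == 0 by rewrite -mxrank_eq0 -leqn0 -db rank_leq_col.
  suff /submxP[D xD] : (1%:M <= kermx (path_mx G i b))%MS.
    by apply: contra x_nz => /eqP x0; rewrite -[x]mul1mx xD -mulmxA x0 mulmx0.
  by rewrite sub_kermx P0 mulmx0.
case: (ex_maxnP exP bndP) => c /andP[le_ic xc] c_max; exists c => // b le_ib.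
apply/idP/idP => [xb | le_bc]; first by apply: c_max; rewrite /P le_ib.
by apply: survives_antitone xc; rewrite le_ib.
Qed.

Lemma full_simple_neq0 G (g : fam k (rdim G) (rdim T)) : row_full (g i) -> g i != 0.
Proof. by rewrite -mxrank_eq0 => /eqP->; rewrite dim_T eqxx. Qed.

Lemma rank_survives d (B : 'M[k]_(d, rdim T i)) : \rank B = (B != 0).
Proof.
rewrite -mxrank_eq0; have := rank_leq_col B; rewrite [X in (_ <= X)%N]dim_T eqxx.
by case: (\rank B) => [|[]].
Qed.

(** [rank_ker_mul] for [g a] and the path from [a] to [b] compares the ranks of [N] and [G]. At
    [a = i] they differ by [1] exactly if [g i] survives to [b]; elsewhere [T] is zero. *)
Lemma short_exact_covers N G f g m l : @short_exact k N G T f g ->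
  rep_iso N (rep_Lam k m) -> rep_iso G (rep_Lam k l) ->
  exists2 c, covers i c m l & forall b, (i <= b)%N -> survives (g i) b = (b <= c)%N.
Proof.
move=> ex /rep_iso_LamP rN /rep_iso_LamP rG; have [_ _ exa] := ex.
have g_nz : g i != 0 by apply: full_simple_neq0; have [] := exa i.
have [c le_ic surv] := survives_max g_nz; exists c => //; split=> // a b le_ab.
have := rank_ker_mul (g a) (path_mx G a b).
rewrite -(short_exact_rank ex) // rN // rG //.
case: (a =P i) le_ab => [-> le_ib | /eqP ne_ai le_ab].
  rewrite !rank_survives g_nz -[_ *m _ != 0]/(~~ survives (g i) b) surv //=; lia.
have T0 : rdim T a = 0%N by rewrite dim_T (negPf ne_ai).
have rank0 d (B : 'M_(d, rdim T a)) : \rank B = 0%N.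
  by apply/eqP; rewrite -leqn0 -[X in (_ <= X)%N]T0 rank_leq_col.
by rewrite !rank0 !addn0 => <-.
Qed.

(** The class of the kernel is covered by [l] at the last vertex to which [g i] survives, and this
    vertex together with [l] determines the class. *)
Lemma short_exact_isoP N G f g c m l : @short_exact k N G T f g ->
  rep_iso G (rep_Lam k l) -> covers i c m l ->
  rep_iso N (rep_Lam k m) <-> survives (g i) c && ~~ survives (g i) c.+1.
Proof.
move=> ex isoG cov; have [le_ic e] := cov; split=> [isoN | /andP[]].
  have [c' cov' surv] := short_exact_covers ex isoN isoG.
  by rewrite !surv ?leqW // -ltnNge ltnS (covers_le cov cov') (covers_le cov' cov).
have [m' isoN] := rep_Lam_exists N; have [c' cov' surv] := short_exact_covers ex isoN isoG.
rewrite !surv ?leqW // -ltnNge ltnS => le_c le_c'.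
suff -> : m = m' by [].
apply: rk_inj => a b le_ab; have [_ e'] := cov'; have := e _ _ le_ab.
rewrite e' //; suff -> : c' = c by move=> /addIn ->.
by apply/eqP; rewrite eqn_leq le_c le_c'.
Qed.

(** The image of the arrow that ends at [j]; no arrow ends at the vertex [0]. *)
Definition arrow_in G j : 'M[k]_(rdim G j) :=
  if j is j'.+1 then <<rmap G j'>>%MS else 0.

(** What a form at [i] must kill in order to define a homomorphism to [T] that survives to [b]. *)
Definition dead_space G b : 'M[k]_(rdim G i) :=
  (arrow_in G i + kermx (path_mx G i b))%MS.

Lemma dead_spaceP G b (x : 'M_(rdim G i, rdim T i)) :
  (dead_space G b *m x == 0) = (arrow_in G i *m x == 0) && survives x b.
Proof.
by rewrite /survives -!sub_kermx addsmx_sub.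
Qed.

(** Modulo the kernel of the path to [b], the image of the incoming arrow has the rank of the path
    from [i - 1] to [b]. So the codimension is [rk l i b] minus [rk l (i - 1) b], which is
    [starts l i b]. *)
Lemma rank_dead_space G l b : rep_iso G (rep_Lam k l) -> (i <= b)%N ->
  (\rank (dead_space G b) + starts l i b = rdim G i)%N.
Proof.
move=> /rep_iso_LamP rG le_ib; have := mxrank_sum_cap (arrow_in G i) (kermx (path_mx G i b)).
have := mxrank_mul_ker (arrow_in G i) (path_mx G i b).
rewrite -/(dead_space G b) mxrank_ker; have := rank_leq_row (path_mx G i b).
have := rk_starts l i b; set z := (if i is j.+1 then rk l j b else 0%N); rewrite rG // => ->.
have -> : \rank (arrow_in G i *m path_mx G i b) = z.
  rewrite /z /arrow_in; case: (i) le_ib => [|j] le_jb; first by rewrite mul0mx mxrank0.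
  by rewrite (eqmxMr _ (genmxE _)) -path_mxSl // rG // ltnW.
move: z => z; lia.
Qed.

Definition simple_form G (x : 'M_(rdim G i, rdim T i)) : fam k (rdim G) (rdim T) :=
  eqtype.dfwith (fun a => 0 : 'M[k]_(rdim G a, rdim T a)) x.

Lemma simple_form_in G (x : 'M_(rdim G i, rdim T i)) : simple_form x i = x.
Proof. exact: eqtype.dfwith_in. Qed.

(** [T] lives at [i] only, so its arrows are zero and the one condition with content is at the arrow
    into [i]. *)
Lemma simple_homP G (g : fam k (rdim G) (rdim T)) : is_hom g <-> arrow_in G i *m g i = 0.
Proof.
have T_col a d (A B : 'M[k]_(d, rdim T a)) : (a == i -> A = B) -> A = B.
  move=> eqAB; have [/eqAB // | /negPf ne_ai] := boolP (a == i).
  apply/matrixP=> u v; have := leq_ltn_trans (leq0n v) (ltn_ord v).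
  by rewrite [X in (0 < X)%N]dim_T ne_ai.
have g_rmap a : g a *m rmap T a = 0.
  apply: T_col => /eqP e; have T0 : rdim T a = 0%N by rewrite dim_T -e ltn_eqF.
  have /eqP -> : g a == 0 by rewrite -mxrank_eq0 -leqn0 -[X in (_ <= X)%N]T0 rank_leq_col.
  by rewrite mul0mx.
have arr0 p q (A : 'M[k]_(p, q)) t (x : 'M_(q, t)) : (<<A>>%MS *m x == 0) = (A *m x == 0).
  by rewrite -!mxrank_eq0 (eqmxMr _ (genmxE _)).
rewrite /arrow_in; split=> [hg | g0 a].
  case: (i) => [|j]; first by rewrite mul0mx.
  by apply/eqP; rewrite arr0 hg g_rmap.
rewrite g_rmap; apply: T_col => /eqP e; move: g0; rewrite -e => /eqP; rewrite arr0.
by move/eqP.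
Qed.

Lemma simple_form_out G q (x : 'M_(rdim G i, rdim T i)) a (A : 'M_(q, rdim G a)) :
  a != i -> A *m simple_form x a = 0.
Proof.
by move=> ne_ai; rewrite [simple_form x a]eqtype.dfwith_out ?mulmx0 // eq_sym.
Qed.

Lemma simple_formE G (g : fam k (rdim G) (rdim T)) a : g a = simple_form (g i) a.
Proof.
have [-> | ne_ai] := eqVneq a i; first by rewrite simple_form_in.
apply/matrixP=> u v; have := leq_ltn_trans (leq0n v) (ltn_ord v).
by rewrite [X in (0 < X)%N]dim_T (negPf ne_ai).
Qed.

Lemma simple_form_full G (x : 'M_(rdim G i, rdim T i)) a : x != 0 ->
  row_full (simple_form x a).
Proof.
move=> x_nz; rewrite /row_full; have [-> | ne_ai] := eqVneq a i.
  by rewrite simple_form_in rank_survives x_nz [X in _ == X]dim_T eqxx.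
have T0 : rdim T a = 0%N by rewrite dim_T (negPf ne_ai).
by rewrite [X in _ == X]T0 -leqn0 -[X in (_ <= X)%N]T0 rank_leq_col.
Qed.

(** The dead space at [c.+1] has larger dimension than the one at [c], so some form kills the second
    but not the first. Its kernel has the class [m]. *)
Lemma covers_short_exact N G c m l : covers i c m l ->
  rep_iso N (rep_Lam k m) -> rep_iso G (rep_Lam k l) ->
  exists f g, @short_exact k N G T f g.
Proof.
move=> cov isoN isoG; have [le_ic _] := cov.
have rk_c := rank_dead_space isoG le_ic; have rk_c1 := rank_dead_space isoG (leqW le_ic).
have [] := @exists_form _ (rdim T i) _ _ (dead_space G c) (dead_space G c.+1).
- by rewrite dim_T eqxx.
- apply/negP=> /mxrankS; have := covers_starts_lt cov; lia.
move=> x [/eqP]; rewrite !dead_spaceP => /andP[arr_x xc]; rewrite arr_x /= => xc1.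
have x_nz : x != 0 by apply: contraNneq xc1 => ->; rewrite /survives mulmx0.
have hg : is_hom (simple_form x) by apply/simple_homP; rewrite simple_form_in; apply/eqP.
have ex := ker_rep_exact hg (fun a => simple_form_full a x_nz).
have isoK : rep_iso (ker_rep (simple_form x)) (rep_Lam k m).
  by apply/(short_exact_isoP ex isoG cov); rewrite simple_form_in xc.
have [f ex_f] : exists f, @short_exact k N G T f (simple_form x).
  apply: short_exact_iso (rep_iso_trans isoN (rep_iso_sym isoK)) _.
  by exists (ker_incl (simple_form x)).
by exists f, (simple_form x).
Qed.

End SimpleQuotients.

(** * Hall polynomials *)

Lemma card_eq_inj_finset U (F : finType) (A : set U) (f : U -> F) (Z : {set F}) :
  (forall x y, A x -> A y -> f x = f y -> x = y) ->
  (forall z, z \in Z <-> exists2 x, A x & f x = z) -> (A #= `I_#|Z|)%card.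
Proof.
move=> f_inj fZ; have /card_esym fA : (f @` A #= A)%card.
  by apply: inj_card_eq => x y /set_mem Ax /set_mem Ay; apply: f_inj.
apply: card_eq_trans fA _; have -> : (f @` A = [set` [fset z in Z]%fset])%classic.
  by apply/seteqP; split=> z /=; rewrite in_fset => /fZ.
by apply/card_eq_fsetP; rewrite card_finset.
Qed.

(** * Counting hyperplanes over a finite field *)

Section LinearForms.
Variable k : finFieldType.

Lemma card_annihilator p d (A : 'M[k]_(p, d)) :
  #|[set x : 'cV[k]_d | A *m x == 0]| = (#|k| ^ (d - \rank A))%N.
Proof.
rewrite -mxrank_tr -mxrank_ker -card_rowg -(card_imset _ (@trmx_inj _ _ _)).
apply: eq_card => u; apply/imsetP/idP => [[x] | ].
  by rewrite !inE => /eqP Ax ->; rewrite sub_kermx -trmx_mul Ax trmx0.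
rewrite inE sub_kermx => /eqP uA; exists u^T; rewrite ?trmxK // inE.
by rewrite -[A]trmxK -trmx_mul uA trmx0.
Qed.

(* Hyperplanes are counted as linear forms up to the [#|k| - 1] nonzero scalars. *)
Lemma card_hyperplanes t p q d (A : 'M[k]_(p, d)) (B : 'M[k]_(q, d)) :
  t = 1%N -> (A <= B)%MS ->
  (#|[set [set v : 'rV[k]_d | v *m x == 0%R] |
      x in [set x : 'M[k]_(d, t) | (A *m x == 0%R) && (B *m x != 0%R)]]|
    * #|k|.-1 + #|k| ^ (d - \rank B) = #|k| ^ (d - \rank A))%N.
Proof.
move=> -> {t} sAB; set X := [set x | _]; set h := fun x => _.
rewrite -!card_annihilator; set XA := [set x | A *m x == 0]; set XB := [set x | B *m x == 0].
have -> : #|XA| = (#|X| + #|XB|)%N.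
  rewrite addnC -(cardsID XB XA); congr (_ + _)%N; apply: eq_card => x; last first.
    by rewrite !inE andbC.
  rewrite !inE; apply/andb_idl => /eqP Bx; have /submxP[D ->] := sAB.
  by rewrite -mulmxA Bx mulmx0.
(* The forms are grouped by their hyperplane; each group consists of the nonzero multiples of one
   form. *)
congr (_ + _)%N; rewrite -[#|X|]sum1_card (partition_big_imset h) /= -sum_nat_const.
apply: eq_bigr => _ /imsetP[x Xx ->].
have x_nz : x != 0.
  by apply: contraTneq Xx => ->; rewrite inE !mulmx0 !eqxx.
rewrite sum1_card -(cardC1 (0 : k)).
have scale_inj : injective (fun c : k => c *: x).
  move=> c c' /eqP; rewrite -subr_eq0 -scalerBl scaler_eq0 (negPf x_nz) orbF subr_eq0.
  by move/eqP.
rewrite -(card_imset _ scale_inj); apply: eq_card => y; apply/imsetP/andP => [[c] | [Xy /eqP hy]].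
  rewrite !inE => c_nz ->; split.
    move: Xx; rewrite !inE -!scalemxAr !scaler_eq0 (negPf c_nz) /=.
    by case/andP=> -> ->.
  by apply/eqP/setP=> v; rewrite !inE -scalemxAr scaler_eq0 (negPf c_nz).
have y_nz : y != 0.
  by apply: contraTneq Xy => ->; rewrite inE !mulmx0 !eqxx.
(* Forms with the same hyperplane are proportional: the rows of [1 - x *m pinvmx x] are killed by
   [x], hence by [y]. *)
have eqy : y = x *m (pinvmx x *m y).
  apply/eqP; rewrite mulmxA -subr_eq0 -{1}[y]mul1mx -mulmxBl; apply/eqP/row_matrixP=> u.
  rewrite row_mul row0; apply/eqP.
  have : row u (1%:M - x *m pinvmx x) \in h x.
    by rewrite inE -row_mul mulmxBl mul1mx mulmxKpV ?submx_refl // subrr row0.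
  by rewrite -hy inE.
exists ((pinvmx x *m y) 0 0); last first.
  by rewrite {1}eqy [pinvmx x *m y in LHS]mx11_scalar mul_mx_scalar.
rewrite !inE; apply: contraNneq y_nz => c0.
by rewrite eqy [pinvmx x *m y]mx11_scalar c0 mul_mx_scalar scale0r.
Qed.

End LinearForms.

(** * Members of Hall sets as kernels of homomorphisms *)

Section HallSets.
Variable k : fieldType.
Implicit Types (M Y : rep k).

Lemma subquo_kerP M Y q (g : fam k (rdim M) q) (U : subfam M) : stable_ker g ->
  (forall a v, v \in U a <-> v *m g a = 0) ->
  subquo_iso U (@subfam0 k M) Y <-> rep_iso (ker_rep g) Y.
Proof.
move=> hg gU.
(* [B] turns coordinates in the kernel into vectors of [M], and [C] recovers the coordinates. *)
have [B [C [B_hom BC inclU UB]]] : exists (B : fam k (rdim (ker_rep g)) (rdim M))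
    (C : fam k (rdim M) (rdim (ker_rep g))), [/\ is_hom B, forall a, B a *m C a = 1%:M,
    forall a (w : 'rV_(rdim (ker_rep g) a)), w *m B a \in U a &
    forall a v, v \in U a -> v = v *m C a *m B a].
  exists (ker_incl g), (fun a => pinvmx (ker_incl g a)); split=> [|a|a w|a v].
  - exact: ker_incl_hom.
  - by rewrite mulmxVp // row_base_free.
  - by apply/gU; apply/eqP; rewrite -sub_kermx (submx_trans (submxMl _ _)) ?eq_row_base.
  by move=> /gU/eqP vg; rewrite mulmxKpV // eq_row_base sub_kermx.
split=> [[h [h_hom h_full h_ker]] | /rep_isoP[f [f' [hf _ ff' f'f]]]].
  exists (fun a => B a *m h a) => a.
    rewrite mulmxA B_hom; apply/row_matrixP=> u.
    have := inclU a (delta_mx 0 u); rewrite -rowE => /h_hom.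
    by rewrite -!row_mul.
  apply/andP; split.
    rewrite -kermx_eq0 -submx0; apply/row_subP=> u.
    have := row_sub u (kermx (B a *m h a)); rewrite sub_kermx mulmxA => /eqP uh.
    have /h_ker := inclU a (row u (kermx (B a *m h a))).
    move=> [/(_ uh)]; rewrite memv0 => /eqP u0 _.
    by rewrite -[row u _]mulmx1 -BC mulmxA u0 mul0mx sub0mx.
  rewrite -sub1mx; apply/row_subP=> u; have [v Uv <-] := h_full a (row u 1%:M).
  by rewrite (UB _ _ Uv) -mulmxA submxMl.
exists (fun a => C a *m f a); split=> [a v Uv | a y | a v Uv].
- rewrite {1}(UB _ _ Uv); move: (v *m C a) (mulmxA v (C a) (f a)) => w ->.
  rewrite -(mulmxA w (B a)) -B_hom (mulmxA w (rmap (ker_rep g) a)).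
  rewrite -(mulmxA _ (B a.+1)) (mulmxA (B a.+1)) BC.
  by rewrite mul1mx -(mulmxA w (rmap (ker_rep g) a)) hf mulmxA.
- exists (y *m f' a *m B a); first exact: inclU.
  by rewrite -!mulmxA (mulmxA (B a)) BC mul1mx f'f mulmx1.
rewrite memv0; split=> [vf | /eqP->]; last exact: mul0mx.
have vC : v *m C a = 0 by rewrite -[LHS]mulmx1 -ff' mulmxA -(mulmxA v) vf mul0mx.
by rewrite (UB _ _ Uv) vC mul0mx.
Qed.

End HallSets.

Section HallNumbers.
Implicit Types (l m : Lam).

Lemma rdim_rep_Lam k l a : rdim (rep_Lam k l) a = rk l a a.
Proof. by rewrite -(rank_rep_sum k) // path_mxx mxrank1. Qed.

Lemma rdim_simple k i a : rdim (rep_Lam k [mset simple_root i]%mset) a = (a == i).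
Proof. by rewrite rdim_rep_Lam enum_msetn /rk /= addn0 eq_sym eqn_leq andbC. Qed.

Variable i : nat.
Let S k := rep_Lam k [mset simple_root i]%mset.
Let dim_S k : forall a, rdim (S k) a = (a == i) := @rdim_simple k i.

Lemma hall_set_forms k m l U : hall_set k [mset simple_root i]%mset m l U ->
  exists g : fam k (rdim (rep_Lam k l)) (rdim (S k)), [/\ is_hom g,
    forall a, row_full (g a), rep_iso (ker_rep g) (rep_Lam k m) &
    forall a v, v \in U a <-> v *m g a = 0].
Proof.
case=> _ isoU [g [g_hom g_full g_ker]].
have gh : is_hom g by move=> a; apply/row_matrixP=> u; rewrite !rowE !mulmxA g_hom ?memvf.
have gU a v : v \in U a <-> v *m g a = 0 by have [] := g_ker a v (memvf v).
exists g; split=> // [a|].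
  rewrite -sub1mx; apply/row_subP=> u; have [v _ <-] := g_full a (row u 1%:M).
  exact: submxMl.
by apply/(subquo_kerP _ (hom_stable_ker gh) gU).
Qed.

Lemma forms_hall_set k m l (U : subfam (rep_Lam k l))
    (g : fam k (rdim (rep_Lam k l)) (rdim (S k))) :
  is_hom g -> (forall a, row_full (g a)) -> rep_iso (ker_rep g) (rep_Lam k m) ->
  (forall a v, v \in U a <-> v *m g a = 0) ->
  hall_set k [mset simple_root i]%mset m l U.
Proof.
move=> gh g_full isoK gU; split.
- by move=> a v /gU va; apply/gU; rewrite -mulmxA gh mulmxA va mul0mx.
- exact/(subquo_kerP _ (hom_stable_ker gh) gU).
exists g; split=> [a v _ | a y | a v _]; last by split=> /gU.
  by rewrite -mulmxA gh mulmxA.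
exists (y *m pinvmx (g a)); first exact: memvf.
by rewrite -mulmxA mulVpmx // mulmx1.
Qed.

Lemma hall_set_covers k m l U : hall_set k [mset simple_root i]%mset m l U ->
  exists c, covers i c m l.
Proof.
move=> /hall_set_forms[g [gh g_full isoK _]].
have [c cov _] := short_exact_covers (@dim_S k) (ker_rep_exact gh g_full) isoK (rep_iso_refl _).
by exists c.
Qed.

(** The members are the kernels of forms at [i] that kill the dead space at [c] but not the one at
    [c.+1]. Hence they are counted by hyperplanes, and [rank_dead_space] gives the exponents. *)
Lemma card_hall_set (k : finFieldType) c m l : covers i c m l ->
  exists n, (hall_set k [mset simple_root i]%mset m l #= `I_n)%card /\
    (n * #|k|.-1 + #|k| ^ starts l i c.+1 = #|k| ^ starts l i c)%N.
Proof.
move=> cov; have [le_ic _] := cov; set M := rep_Lam k l.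
pose A := dead_space i M c; pose B := dead_space i M c.+1.
have S1 : rdim (S k) i = 1%N by rewrite dim_S eqxx.
have sAB : (A <= B)%MS.
  by rewrite addsmxS // sub_kermx path_mxSr // mulmxA mulmx_ker mul0mx.
have := card_hyperplanes S1 sAB; set Z := imset _ _ => cardZ.
exists #|Z|; split; last first.
  have rA : (\rank A + starts l i c = rdim M i)%N := rank_dead_space (rep_iso_refl M) le_ic.
  have rB : (\rank B + starts l i c.+1 = rdim M i)%N.
    exact: rank_dead_space (rep_iso_refl M) (leqW le_ic).
  by rewrite -(addKn (\rank A) (starts l i c)) -(addKn (\rank B) (starts l i c.+1)) rA rB.
have AB_P (x : 'M_(rdim M i, rdim (S k) i)) : (A *m x == 0) && (B *m x != 0) ->
  [/\ is_hom (simple_form x), forall a, row_full (simple_form x a) &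
      rep_iso (ker_rep (simple_form x)) (rep_Lam k m)].
  rewrite !dead_spaceP => /andP[/andP[arr_x xc]]; rewrite arr_x /= => xc1.
  have x_nz : x != 0 by apply: contraNneq xc1 => ->; rewrite /survives mulmx0.
  have hx : is_hom (simple_form x).
    by apply/(simple_homP (@dim_S k)); rewrite simple_form_in; apply/eqP.
  have x_full a := simple_form_full (@dim_S k) a x_nz.
  split=> //; apply/(short_exact_isoP (@dim_S k) (ker_rep_exact hx x_full) (rep_iso_refl _) cov).
  by rewrite simple_form_in xc.
have hallP U : hall_set k [mset simple_root i]%mset m l U -> exists x : 'M_(rdim M i, rdim (S k) i),
    (A *m x == 0) && (B *m x != 0) /\ forall a v, v \in U a <-> v *m simple_form x a = 0.
  move=> /hall_set_forms[g [gh g_full isoK gU]]; exists (g i); split.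
    have [/= gc gc1] := andP (proj1 (short_exact_isoP (@dim_S k) (ker_rep_exact gh g_full)
      (rep_iso_refl _) cov) isoK).
    have /eqP arr := proj1 (simple_homP (@dim_S k) g) gh.
    by rewrite !dead_spaceP arr gc gc1.
  by move=> a v; rewrite -(simple_formE (@dim_S k)).
have mem_form (U : subfam M) (x : 'M_(rdim M i, rdim (S k) i)) :
    (forall a v, v \in U a <-> v *m simple_form x a = 0) ->
    forall v, (v \in U i) = (v *m x == 0).
  by move=> /(_ i) xU v; have := xU v; rewrite simple_form_in => -[h1 h2]; apply/idP/eqP.
(* Away from [i] a member is the whole space, so its space at [i] determines it. *)
apply: (@card_eq_inj_finset _ _ _ (fun U : subfam M => [set v | v \in U i])) => [U U' | z].
  move=> /hallP[x [_ xU]] /hallP[x' [_ xU']] /setP eqUU'.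
  apply: functional_extensionality_dep => a; apply/vspaceP => v.
  have [ea | ne_ai] := eqVneq a i; first by move: v; rewrite ea => v; have := eqUU' v; rewrite !inE.
  by apply/idP/idP=> _; [apply/xU' | apply/xU]; rewrite simple_form_out.
split=> [/imsetP[x] | [U /hallP[x [xAB xU]] <-]]; last first.
  by apply/imsetP; exists x; [rewrite inE | apply/setP=> v; rewrite !inE (mem_form _ _ xU)].
rewrite inE => /AB_P[hx x_full isoK] ->.
pose U : subfam M := fun a => lker (linfun (mulmxr (simple_form x a))).
have xU a v : v \in U a <-> v *m simple_form x a = 0.
  by rewrite memv_ker lfunE /=; split=> [/eqP|->].
exists U; first exact: forms_hall_set xU.
by apply/setP=> v; rewrite !inE (mem_form _ _ xU).
Qed.

(** Two polynomials with the defining property agree at every prime, so their difference has more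
    roots than its degree allows. *)
Lemma hall_poly_eq a b l (P : {poly int}) :
  (forall k : finFieldType, exists2 n, (hall_set k a b l #= `I_n)%card & P.[#|k|%:R] = n%:R) ->
  hall_poly a b l = P.
Proof.
move=> hP; apply: xget_unique => // Q hQ; apply/eqP; rewrite -subr_eq0; apply/eqP.
have [s [s_uniq s_root s_size]] : exists s : seq nat,
    [/\ uniq s, all (fun p => root (Q - P) p%:R) s & size s = size (Q - P)].
  elim: (size _) => [|n [s [s_uniq s_root s_size]]]; first by exists nil.
  (* A prime above the sum of the earlier ones is new. *)
  have [p lt_p pr_p] := prime_above (\sum_(q <- s) q)%N.
  exists (p :: s); split; rewrite /= ?s_size ?s_uniq ?s_root ?andbT //.
    apply/negP=> ps; move: lt_p; rewrite (big_rem p) //=; lia.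
  have [n1 card1 P1] := hP 'F_p; have [n2 card2 Q2] := hQ 'F_p.
  rewrite card_Fp // in P1 Q2; rewrite /root !hornerE P1 Q2 subr_eq0 eqr_nat.
  by apply/eqP/card_eq_II/(card_eq_trans _ card1); rewrite card_eq_sym.
apply: (@roots_geq_poly_eq0 _ _ [seq p%:R | p <- s]).
- by rewrite all_map.
- by rewrite map_inj_uniq // => p q /eqP; rewrite eqr_nat => /eqP.
by rewrite size_map s_size.
Qed.

Lemma hall_poly_covers c m l : covers i c m l ->
  hall_poly [mset simple_root i]%mset m l =
  \sum_(starts l i c.+1 <= j < starts l i c) 'X^j.
Proof.
move=> cov; apply: hall_poly_eq => k; have [n [card_n eq_n]] := card_hall_set k cov.
exists n => //; rewrite horner_sum.
under eq_bigr do rewrite hornerXn -natrX.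
rewrite -natr_sum; congr (_%:R).
have q_gt1 : (1 < #|k|)%N by exact: card_finNzRing_gt1.
(* The geometric sum satisfies the same equation as [n], and [#|k|.-1] can be cancelled. *)
suff : ((\sum_(starts l i c.+1 <= j < starts l i c) #|k| ^ j) * #|k|.-1 +
  #|k| ^ starts l i c.+1 = #|k| ^ starts l i c)%N.
  rewrite -eq_n => /addIn /eqP; rewrite eqn_pmul2r; first by move/eqP.
  by case: #|k| q_gt1 => [|[]].
have := ltnW (covers_starts_lt cov); elim: (starts l i c) => [|t IHt].
  by rewrite leqn0 => /eqP->; rewrite big_geq // mul0n.
rewrite leq_eqVlt => /orP[/eqP<- | ]; first by rewrite big_geq // mul0n.
rewrite ltnS => le_t; rewrite big_nat_recr //= mulnDl addnAC IHt // expnS.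
by rewrite -{1}[(#|k| ^ t)%N]muln1 -mulnDr addnC addn1 prednK 1?ltnW // mulnC.
Qed.

Lemma hall_poly_neq0 m l : hall_poly [mset simple_root i]%mset m l != 0 ->
  exists c, covers i c m l.
Proof.
apply: contraPP => ncov; apply/negP; rewrite negbK; apply/eqP/hall_poly_eq => k.
exists 0%N; rewrite ?horner0 // II0 card_eq0; apply/eqP/seteqP; split=> // U.
by move=> /hall_set_covers.
Qed.

End HallNumbers.

(** * Generic extensions *)

Section HomDimension.
Variable k : fieldType.
Implicit Types (M N : rep k).

(** The two matrices of coordinates of one basis in the other multiply to the identity, since
    coordinates are unique. *)
Lemma has_dim_leq p q (P : fam k p q -> Prop) n n' :
  has_dim P (fun f g => forall i, f i = g i) n ->
  has_dim P (fun f g => forall i, f i = g i) n' -> (n <= n')%N.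
Proof.
move=> [b Pb coord] [b' Pb' coord'].
have /choice[A bA] : forall j, exists c : 'rV_n', forall i, b j i = \sum_l c 0 l *: b' l i.
  by move=> j; have [c [? _]] := coord' _ (Pb j); exists c.
have /choice[B bB] : forall j, exists c : 'rV_n, forall i, b' j i = \sum_l c 0 l *: b l i.
  by move=> j; have [c [? _]] := coord _ (Pb' j); exists c.
apply: (@mulmx1_min _ _ _ (\matrix_(j, l) A j 0 l) (\matrix_(l, j) B l 0 j)).
apply/row_matrixP=> j; have [c [_ c_uniq]] := coord _ (Pb j).
rewrite row1 -[LHS]c_uniq; last first.
  move=> i; rewrite bA; under eq_bigr do rewrite bB scaler_sumr.
  rewrite exchange_big; apply: eq_bigr => m _; rewrite !mxE scaler_suml.
  by apply: eq_bigr => l _; rewrite scalerA !mxE.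
apply: c_uniq => i; rewrite (bigD1 j) //= big1 ?addr0 => [|m /negPf ne_mj].
  by rewrite mxE !eqxx scale1r.
by rewrite mxE ne_mj andbF scale0r.
Qed.

(* [hom_param M N n]: a linear bijection from [k^n] to [Hom(M, N)]. *)
Definition hom_param M N n : Prop :=
  exists L : 'rV[k]_n -> fam k (rdim M) (rdim N),
    [/\ forall a c c' i, L (a *: c + c') i = a *: L c i + L c' i,
        forall c, is_hom (L c),
        forall f, @is_hom k M N f -> exists c, forall i, f i = L c i &
        forall c, (forall i, L c i = 0) -> c = 0].

Lemma hom_dim_param M N n : hom_param M N n -> hom_dim M N = n.
Proof.
move=> [L [L_lin L_hom L_surj L_inj]].
have L0 i : L 0 i = 0.
  by have := L_lin 1 0 0 i; rewrite scaler0 scale1r addr0 -{1}[L 0 i]addr0 => /addrI.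
have LD i : {morph (fun c => L c i) : c c' / c + c'}.
  by move=> c c'; rewrite -[c]scale1r L_lin !scale1r.
have LZ a c i : L (a *: c) i = a *: L c i by rewrite -[a *: c]addr0 L_lin L0 addr0.
have LE c i : L c i = \sum_j c 0 j *: L (delta_mx 0 j) i.
  rewrite {1}[c]row_sum_delta (big_morph _ (LD i) (L0 i)).
  by apply: eq_bigr => j _; rewrite LZ.
have dimL : has_dim [set f : fam k (rdim M) (rdim N) | is_hom f]%classic
    (fun f g => forall i, f i = g i) n.
  exists (fun j => L (delta_mx 0 j)) => [j | f /L_surj[c fc]]; first exact: L_hom.
  exists c; split=> [i | c' fc']; first by rewrite fc LE.
  apply/eqP; rewrite -subr_eq0; apply/eqP/L_inj => i.
  by rewrite -scaleN1r addrC L_lin scaleN1r [L c' i]LE -fc' fc addNr.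
apply: xget_unique => // n' dim'; apply/eqP; rewrite eqn_leq.
by apply/andP; split; [exact: has_dim_leq dim' dimL | exact: has_dim_leq dimL dim'].
Qed.

Lemma hom_param_iso M M' N N' n : rep_iso M M' -> rep_iso N N' ->
  hom_param M N n -> hom_param M' N' n.
Proof.
move=> /rep_isoP[f [f' [hf hf' ff' f'f]]] /rep_isoP[g [g' [hg hg' gg' g'g]]].
move=> [L [L_lin L_hom L_surj L_inj]].
exists (fun c i => f' i *m L c i *m g i); split=> [a c c' i | c | h hh | c Lc].
- by rewrite L_lin mulmxDr mulmxDl -scalemxAr -scalemxAl.
- exact: is_hom_mul (is_hom_mul hf' (L_hom c)) hg.
- have [c hc] := L_surj _ (is_hom_mul (is_hom_mul hf hh) hg'); exists c => i.
  by rewrite -hc -!mulmxA g'g mulmx1 mulmxA f'f mul1mx.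
apply: L_inj => i; rewrite -[L c i]mul1mx -ff' -mulmxA -[f' i *m _]mulmx1 -gg' (mulmxA _ (g i)) Lc.
by rewrite mul0mx mulmx0.
Qed.

Lemma hom_param_addl M1 M2 N n1 n2 : hom_param M1 N n1 -> hom_param M2 N n2 ->
  hom_param (rep_add M1 M2) N (n1 + n2).
Proof.
move=> [L1 [lin1 hom1 surj1 inj1]] [L2 [lin2 hom2 surj2 inj2]].
exists (fun c i => col_mx (L1 (lsubmx c) i) (L2 (rsubmx c) i)).
split=> [a c c' i | c i | f hf | c Lc].
- by rewrite !linearP /= lin1 lin2 scale_col_mx add_col_mx.
- rewrite [LHS]mul_block_col !mul0mx addr0 add0r mul_col_mx.
  by rewrite hom1 hom2.
- have hf' i : block_mx (rmap M1 i) 0 0 (rmap M2 i) *m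
      col_mx (usubmx (f i.+1)) (dsubmx (f i.+1)) = col_mx (usubmx (f i)) (dsubmx (f i)) *m rmap N i.
    by rewrite !vsubmxK; apply: hf.
  have {}hf' i : rmap M1 i *m usubmx (f i.+1) = usubmx (f i) *m rmap N i /\
      rmap M2 i *m dsubmx (f i.+1) = dsubmx (f i) *m rmap N i.
    by have := hf' i; rewrite mul_block_col mul_col_mx !mul0mx addr0 add0r => /eq_col_mx.
  have [c1 fc1] := surj1 (fun i => usubmx (f i)) (fun i => (hf' i).1).
  have [c2 fc2] := surj2 (fun i => dsubmx (f i)) (fun i => (hf' i).2).
  exists (row_mx c1 c2) => i; rewrite row_mxKl row_mxKr -fc1 -fc2; exact: esym (vsubmxK _).
have Lc' i : L1 (lsubmx c) i = 0 /\ L2 (rsubmx c) i = 0.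
  by have := Lc i; rewrite -[0]/(0 : 'M_(_ + _, _)) -col_mx0 => /eq_col_mx.
by rewrite -[c]hsubmxK (inj1 _ (fun i => (Lc' i).1)) (inj2 _ (fun i => (Lc' i).2)) row_mx0.
Qed.

Lemma hom_param_addr M N1 N2 n1 n2 : hom_param M N1 n1 -> hom_param M N2 n2 ->
  hom_param M (rep_add N1 N2) (n1 + n2).
Proof.
move=> [L1 [lin1 hom1 surj1 inj1]] [L2 [lin2 hom2 surj2 inj2]].
exists (fun c i => row_mx (L1 (lsubmx c) i) (L2 (rsubmx c) i)).
split=> [a c c' i | c i | f hf | c Lc].
- by rewrite !linearP /= lin1 lin2 scale_row_mx add_row_mx.
- rewrite [RHS]mul_row_block !mulmx0 addr0 add0r mul_mx_row.
  by rewrite hom1 hom2.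
- have hf' i : rmap M i *m row_mx (lsubmx (f i.+1)) (rsubmx (f i.+1)) =
      row_mx (lsubmx (f i)) (rsubmx (f i)) *m block_mx (rmap N1 i) 0 0 (rmap N2 i).
    by rewrite !hsubmxK; apply: hf.
  have {}hf' i : rmap M i *m lsubmx (f i.+1) = lsubmx (f i) *m rmap N1 i /\
      rmap M i *m rsubmx (f i.+1) = rsubmx (f i) *m rmap N2 i.
    by have := hf' i; rewrite mul_row_block mul_mx_row !mulmx0 addr0 add0r => /eq_row_mx.
  have [c1 fc1] := surj1 (fun i => lsubmx (f i)) (fun i => (hf' i).1).
  have [c2 fc2] := surj2 (fun i => rsubmx (f i)) (fun i => (hf' i).2).
  exists (row_mx c1 c2) => i; rewrite row_mxKl row_mxKr -fc1 -fc2; exact: esym (hsubmxK _).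
have Lc' i : L1 (lsubmx c) i = 0 /\ L2 (rsubmx c) i = 0.
  by have := Lc i; rewrite -[0]/(0 : 'M_(_, _ + _)) -row_mx0 => /eq_row_mx.
by rewrite -[c]hsubmxK (inj1 _ (fun i => (Lc' i).1)) (inj2 _ (fun i => (Lc' i).2)) row_mx0.
Qed.

Lemma hom_param_0 M N : (forall f, @is_hom k M N f -> forall i, f i = 0) -> hom_param M N 0.
Proof.
move=> f0; exists (fun _ _ => 0); split=> [a c c' i | c i | f /f0 hf | c _].
- by rewrite scaler0 addr0.
- by rewrite mul0mx mulmx0.
- by exists 0 => i; rewrite hf.
exact: thinmx0.
Qed.

(** The image of a nonzero map is a quotient of the first indecomposable and a subrepresentation of
    the second, hence the interval from [(val r).1] to [(val s).2]. *)
Definition hom_root (r s : Defs.root) : bool :=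
  ((val s).1 <= (val r).1 <= (val s).2)%N && ((val s).2 <= (val r).2)%N.

Lemma hom_param_root (r s : Defs.root) :
  hom_param (rep_root k r) (rep_root k s) (hom_root r s).
Proof.
set R := rep_root k r; set S := rep_root k s.
(* The only entry of [f i] if both spaces are nonzero, and an empty sum otherwise; this avoids casts
   to dimension [1]. *)
pose e (f : fam k (rdim R) (rdim S)) i := \sum_u \sum_v f i u v.
have dim_r i (u : 'I_(rdim R i)) : ((val r).1 <= i <= (val r).2)%N.
  by have := leq_ltn_trans (leq0n u) (ltn_ord u); rewrite /= /root_dim lt0b.
have dim_s i (u : 'I_(rdim S i)) : ((val s).1 <= i <= (val s).2)%N.
  by have := leq_ltn_trans (leq0n u) (ltn_ord u); rewrite /= /root_dim lt0b.
have fE f i : f i = const_mx (e f i).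
  apply/matrixP=> u v; rewrite mxE /e; have ru := dim_r i u; have sv := dim_s i v.
  move: (f i) u v; rewrite /= /root_dim ru sv => A u v.
  by rewrite !big_ord_recl !big_ord0 !addr0 (ord1 u) (ord1 v).
have eS f i : is_hom f -> ((val r).1 <= i <= (val r).2)%N -> ((val s).1 <= i.+1 <= (val s).2)%N ->
    e f i.+1 *+ ((val r).1 <= i.+1 <= (val r).2)%N = e f i *+ ((val s).1 <= i <= (val s).2)%N.
  move=> hf ri si; have := hf i; rewrite (fE f i) (fE f i.+1).
  move: (e f i) (e f i.+1) => x y /matrixP /=; rewrite /root_dim ri si => /(_ 0 0).
  rewrite !mxE; under eq_bigr do rewrite !mxE mul1r.
  under [in RHS]eq_bigr do rewrite !mxE mulr1.
  by rewrite !sumr_const !card_ord.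
have e_const f i j : is_hom f -> (i <= j)%N -> ((val r).1 <= i)%N -> ((val s).1 <= i)%N ->
    (j <= (val r).2)%N -> (j <= (val s).2)%N -> e f i = e f j.
  move=> hf; elim: j => [|j IHj]; first by rewrite leqn0 => /eqP->.
  rewrite leq_eqVlt => /orP[/eqP-> // | ]; rewrite ltnS => le_ij ri si rj sj.
  rewrite IHj ?(ltnW rj) ?(ltnW sj) //; have := @eS f j hf.
  rewrite rj sj (ltnW rj) (ltnW sj) !(leq_trans ri) ?(leq_trans si) ?leqW //.
  by move=> /(_ isT isT) /=; rewrite !mulr1n.
have const_in (f : fam k (rdim R) (rdim S)) i x : (((val r).1 <= i <= (val r).2)%N ->
    ((val s).1 <= i <= (val s).2)%N -> e f i = x) -> f i = const_mx x.
  move=> fx; rewrite fE; apply/matrixP=> u v; rewrite !mxE; apply: fx.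
    exact: dim_r u.
  exact: dim_s v.
have rP := valP r; have sP := valP s.
have [/andP[/andP[sr rs] sr2] | ] := boolP (hom_root r s); last first.
  move=> nh; apply: hom_param_0 => f hf i; rewrite (const_in f i 0) //.
  move=> /andP[ri ir] /andP[si i_s]; move: nh; rewrite /hom_root (leq_trans ri i_s) andbT negb_and.
  (* The scalar is constant on the common support. It vanishes at the arrow into [(val s).1], which
     starts outside [s], or at the arrow out of [(val r).2], which leaves [r]. *)
  rewrite -!ltnNge => /orP[lt_rs | lt_rs].
    move: si lt_rs sP (e_const f (val s).1 i hf) (@eS f (val s).1.-1 hf).
    case: (val s).1 => // j; rewrite !ltnS /= => lt_ji le_rj lt_js /(_ lt_ji) <- //; last exact: leqW.
    have lt_jr : (j < (val r).2)%N by apply: leq_trans ir.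
    by rewrite le_rj (ltnW lt_jr) lt_js leqnn (leqW le_rj) lt_jr ltnn => /(_ isT isT).
  rewrite (e_const f i (val r).2) ?(ltnW lt_rs) //; have := @eS f (val r).2 hf.
  rewrite rP leqnn lt_rs (leqW (leq_trans si ir)) ltnn andbF (leq_trans si ir) (ltnW lt_rs).
  by move=> /(_ isT isT) /esym.
exists (fun c i => const_mx (c 0 0)); split=> [a c c' i | c i | f hf | c /(_ (val r).1)].
- by apply/matrixP=> u v; rewrite !mxE.
- apply/matrixP=> u v; have /andP[ri ir] := dim_r i u; have /andP[si i_s] := dim_s i.+1 v.
  rewrite !mxE; under eq_bigr do rewrite !mxE mul1r.
  under [in RHS]eq_bigr do rewrite !mxE mulr1.
  rewrite !sumr_const !card_ord /= /root_dim (leq_trans sr ri) (ltnW i_s).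
  by rewrite (leqW ri) (leq_trans i_s sr2).
- exists (const_mx (e f (val r).1)) => i; rewrite mxE; apply: const_in => /andP[ri ir] /andP[si i_s].
  by apply/esym/e_const.
move/matrixP; rewrite /= /root_dim leqnn rP sr rs => /(_ 0 0); rewrite !mxE => c0.
by apply/rowP=> j; rewrite ord1 mxE.
Qed.

Lemma hom_param_sum (s t : seq Defs.root) :
  hom_param (rep_sum k s) (rep_sum k t) (\sum_(x <- s) \sum_(y <- t) hom_root x y).
Proof.
elim: s => [|x s IHs] /=.
  by rewrite big_nil; apply: hom_param_0 => f _ i; apply: flatmx0.
rewrite big_cons; apply: hom_param_addl => // {IHs s}; elim: t => [|y t IHt] /=.
  by rewrite big_nil; apply: hom_param_0 => f _ i; apply: thinmx0.
by rewrite big_cons; apply: hom_param_addr => //; apply: hom_param_root.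
Qed.

End HomDimension.

Definition hom_num (l m : seq Defs.root) : nat :=
  (\sum_(x <- l) \sum_(y <- m) hom_root x y)%N.

Lemma hom_dim_iso (k : fieldType) (M N : rep k) l m :
  rep_iso M (rep_Lam k l) -> rep_iso N (rep_Lam k m) ->
  hom_dim M N = hom_num (enum_mset l) (enum_mset m).
Proof.
move=> /rep_iso_sym isoM /rep_iso_sym isoN; apply: hom_dim_param.
exact: hom_param_iso isoM isoN (hom_param_sum _ _ _).
Qed.

(** * Generic extensions as maximal covers *)

Section GenericExtension.
Implicit Types (l m : Lam) (s : seq Defs.root).

(** A map out of the indecomposable [x] is the choice of an image of its generator: a vector at
    [(val x).1] that dies at [(val x).2.+1]. *)
Lemma sum_hom_root_r s (x : Defs.root) :
  (\sum_(y <- s) hom_root x y + rk s (val x).1 (val x).2.+1 = rk s (val x).1 (val x).1)%N.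
Proof.
case: x => [[a b] /= le_ab]; rewrite /rk /hom_root /=.
elim: s => [|[[c d] /= le_cd] s IHs] /=; first by rewrite big_nil.
rewrite big_cons /= -IHs; lia.
Qed.

(** Dually, a map into the indecomposable [y] is a form at [(val y).2] that kills the image from the
    vertex before [(val y).1]. *)
Lemma sum_hom_root_l s (y : Defs.root) :
  (\sum_(x <- s) hom_root x y + (if (val y).1 is j.+1 then rk s j (val y).2 else 0) =
   rk s (val y).2 (val y).2)%N.
Proof.
case: y => [[[|j] d] /= le_jd]; rewrite /rk /hom_root /=.
  by rewrite addn0; elim: s => [|x s IHs]; rewrite ?big_nil // big_cons /= IHs.
by elim: s => [|[[a b] /= le_ab] s IHs] /=; rewrite ?big_nil // big_cons /= -IHs; lia.
Qed.

(** Larger ranks mean fewer maps, in either argument, so [hom_num l' l' <= hom_num l l' < hom_num l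
    l]. The second step is strict at the root [i..c], which occurs in [l]. *)
Lemma hom_num_covers_lt i c c' l l' m : covers i c m l -> covers i c' m l' -> (c < c')%N ->
  (hom_num l' l' < hom_num l l)%N.
Proof.
move=> cov [le_ic' e'] lt_cc'; have [le_ic e] := cov.
have rk_diag a : rk l a a = rk l' a a.
  by rewrite e ?e' //; case: eqVneq => // ->; rewrite le_ic le_ic'.
have rk_le a b : (a <= b)%N -> (rk l a b <= rk l' a b)%N.
  move=> le_ab; rewrite e ?e' // leq_add2l; case: (a == i) => //=.
  by case: (leqP b c) => // le_bc; rewrite (leq_trans le_bc (ltnW lt_cc')).
apply: (@leq_ltn_trans (hom_num l l')).
  rewrite /hom_num exchange_big [X in (_ <= X)%N]exchange_big; apply: leq_sum => y _.
  have := sum_hom_root_l l y; have := sum_hom_root_l l' y; rewrite rk_diag.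
  case: (val y).1 (valP y) => [|j] /= le_jy; first by lia.
  by have := rk_le j _ (ltnW le_jy); lia.
have row_le x : (\sum_(y <- l') hom_root x y <= \sum_(y <- l) hom_root x y)%N.
  rewrite -(leq_add2r (rk l (val x).1 (val x).2.+1)) sum_hom_root_r rk_diag.
  by rewrite -(sum_hom_root_r l') leq_add2l rk_le // leqW // (valP x).
set r := mk_root (proj1 cov); have row_lt :
    (\sum_(y <- l') hom_root r y < \sum_(y <- l) hom_root r y)%N.
  rewrite -(ltn_add2r (rk l i c.+1)) (sum_hom_root_r l r) rk_diag -(sum_hom_root_r l' r) ltn_add2l.
  by rewrite e ?e' ?leqW //= eqxx lt_cc' ltnn addn0 addn1.
rewrite /hom_num (big_rem _ (covers_mem cov)) [X in (_ < X)%N](big_rem _ (covers_mem cov)) /=.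
by rewrite -addSn leq_add // leq_sum.
Qed.

(** If a root of [m] began at [i.+1] and reached beyond [c], prolonging it to [i] would give an
    extension with a smaller endomorphism algebra. *)
Lemma generic_ext_covers (k : fieldType) i (N G : rep k) l m :
  rep_iso N (rep_Lam k m) -> rep_iso G (rep_Lam k l) ->
  generic_ext (rep_root k (simple_root i)) N G ->
  exists2 c, covers i c m l &
    forall b, (c < b)%N -> (rk m i.+1 b <= rk m i b)%N.
Proof.
have dim_S a : rdim (rep_root k (simple_root i)) a = (a == i).
  by rewrite /= /root_dim /= eqn_leq andbC.
move=> isoN isoG [[f [g ex]] G_min].
have [c cov _] := short_exact_covers dim_S ex isoN isoG; exists c => // b lt_cb.
rewrite rk_starts addnC -[leqRHS]addn0 leq_add2l leqn0 -[_ == _]negbK -lt0n; apply/negP.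
move=> /(covers_exists (leq_ltn_trans (proj1 cov) lt_cb))[c' [l' [le_bc' cov']]].
have := G_min _ (covers_short_exact dim_S cov' isoN (rep_iso_refl _)).
rewrite (hom_dim_iso isoG isoG) (hom_dim_iso (rep_iso_refl _) (rep_iso_refl _)).
by rewrite leqNgt (hom_num_covers_lt cov cov') // (leq_trans lt_cb).
Qed.

(** The critical pairs are [(i, b)] with [b > c]. There [rk l' i b <= rk l' i.+1 b = rk m' i.+1 b <=
    rk m i.+1 b <= rk m i b = rk l i b]. *)
Lemma covers_rk_le i c c' l l' m m' :
  covers i c m l -> (forall b, (c < b)%N -> (rk m i.+1 b <= rk m i b)%N) ->
  covers i c' m' l' -> (forall a b, (a <= b)%N -> (rk m' a b <= rk m a b)%N) ->
  forall a b, (a <= b)%N -> (rk l' a b <= rk l a b)%N.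
Proof.
move=> [le_ic e] c_max [le_ic' e'] le_mm a b le_ab; have := le_mm _ _ le_ab; rewrite e ?e' //.
have [ea | ] := eqVneq a i; last by rewrite !addn0.
case: (leqP b c) => [_ | lt_cb]; first by rewrite ea /=; lia.
have lt_ib := leq_ltn_trans le_ic lt_cb; rewrite ea addn0 => _.
have := rk_homo_l l' b (leqnSn i); rewrite !e' ?(ltnW lt_ib) // eqxx gtn_eqF // addn0.
by move=> /leq_trans; apply; apply: leq_trans (le_mm _ _ lt_ib) (c_max _ lt_cb).
Qed.

End GenericExtension.

(** * Coefficients of [u_w] *)

Section Coefficients.
Implicit Types (p q : Zrs) (x y : Qrs).

Definition ev1 p : int := p.[1].[1].

Lemma ev1D p q : ev1 (p + q) = ev1 p + ev1 q. Proof. by rewrite /ev1 !hornerD. Qed.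

Lemma ev1M p q : ev1 (p * q) = ev1 p * ev1 q. Proof. by rewrite /ev1 !hornerM. Qed.

(** Divide by [s - 1], and then the remainder, a polynomial in [r], by [r - 1]. *)
Lemma in_idealP q : in_ideal_rs1 q <-> ev1 q = 0.
Proof.
split=> [[a [b ->]] | q0]; first by rewrite /ev1 /pr /ps !hornerE.
have /factor_theorem[a qa] : root q.[1] 1 by apply/eqP.
have /factor_theorem[b qb] : root (q - q.[1]%:P) 1 by rewrite /root !hornerE subrr.
exists a%:P, b; rewrite /pr /ps -polyCB -polyCM -qa -polyC1 -qb addrC subrK //.
Qed.

(* [x] is regular and positive at [r = s = 1]. *)
Definition pos1 x : Prop := exists p q,
  [/\ 0 < ev1 p, 0 < ev1 q & x = FracField.tofrac p / FracField.tofrac q].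

Lemma tofrac_ev1_neq0 p : ev1 p != 0 -> FracField.tofrac p != 0.
Proof. by rewrite tofrac_eq0; apply: contraNneq => ->; rewrite /ev1 !horner0. Qed.

Lemma pos1_neq0 x : pos1 x -> x != 0.
Proof.
by case=> p [q [p0 q0 ->]]; rewrite mulf_neq0 ?invr_eq0 // tofrac_ev1_neq0 // gt_eqF.
Qed.

Lemma pos1_tofrac p : 0 < ev1 p -> pos1 (FracField.tofrac p).
Proof.
by move=> p0; exists p, 1; rewrite /ev1 !hornerE rmorph1 divr1.
Qed.

Lemma pos1_1 : pos1 1.
Proof. by rewrite -tofrac1; apply: pos1_tofrac; rewrite /ev1 !hornerE. Qed.

Lemma pos1D x y : pos1 x -> pos1 y -> pos1 (x + y).
Proof.
move=> [p [q [p0 q0 ->]]] [p' [q' [p0' q0' ->]]].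
exists (p * q' + p' * q), (q * q'); rewrite ev1D !ev1M; split.
- by rewrite addr_gt0 // mulr_gt0.
- by rewrite mulr_gt0.
by rewrite rmorphD !rmorphM addf_div // tofrac_ev1_neq0 // gt_eqF.
Qed.

Lemma pos1M x y : pos1 x -> pos1 y -> pos1 (x * y).
Proof.
move=> [p [q [p0 q0 ->]]] [p' [q' [p0' q0' ->]]].
exists (p * p'), (q * q'); rewrite !ev1M; split; try by rewrite mulr_gt0.
by rewrite !rmorphM mulf_div.
Qed.

Lemma pos1V x : pos1 x -> pos1 x^-1.
Proof. by move=> [p [q [p0 q0 ->]]]; exists q, p; rewrite invf_div. Qed.

Lemma pos1X x n : pos1 x -> pos1 (x ^+ n).
Proof.
by move=> x0; elim: n => [|n IHn]; [exact: pos1_1 | rewrite exprS; apply: pos1M].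
Qed.

Lemma pos1_ss : pos1 ss.
Proof. by apply: pos1_tofrac; rewrite /ev1 /ps !hornerE. Qed.

Lemma pos1_rr : pos1 rr.
Proof. by apply: pos1_tofrac; rewrite /ev1 /pr !hornerE. Qed.

Lemma pos1_ssz (n : int) : pos1 (ss ^ n).
Proof.
by case: n => n; [|apply: pos1V]; apply: pos1X; apply: pos1_ss.
Qed.

(** A nonzero element with value [0] at [r = s = 1] is excluded, so sums of such elements cannot
    cancel. *)
Definition nneg1 x : Prop := x = 0 \/ pos1 x.

Lemma nneg1D x y : nneg1 x -> nneg1 y -> nneg1 (x + y).
Proof.
move=> [->|x0] [->|y0]; rewrite ?add0r ?addr0; [by left | by right | by right |].
by right; apply: pos1D.
Qed.

Lemma nneg1M x y : nneg1 x -> nneg1 y -> nneg1 (x * y).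
Proof.
move=> [->|x0] [->|y0]; rewrite ?mul0r ?mulr0; [by left | by left | by left |].
by right; apply: pos1M.
Qed.

Lemma pos1_nneg1D x y : pos1 x -> nneg1 y -> pos1 (x + y).
Proof. by move=> x0 [->|y0]; rewrite ?addr0 //; apply: pos1D. Qed.

Lemma nneg1_sum (I : Type) (r : seq I) (P : pred I) F :
  (forall j, P j -> nneg1 (F j)) -> nneg1 (\sum_(j <- r | P j) F j).
Proof. by move=> F0; apply: big_ind => //; [left | exact: nneg1D]. Qed.

Lemma pos1_sum (I : eqType) (r : seq I) F j0 : j0 \in r -> pos1 (F j0) ->
  (forall j, nneg1 (F j)) -> pos1 (\sum_(j <- r) F j).
Proof.
move=> r0 F0 Fj; rewrite (big_rem _ r0); apply: pos1_nneg1D => //.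
exact: nneg1_sum.
Qed.

Definition hall_coef (a b l : Lam) : Qrs :=
  ss ^ (- euler a b) * (map_poly intr (hall_poly a b l)).[rr / ss].

(** The coefficient is a power of [s] times a nonempty sum of powers of [r / s]. *)
Lemma hall_coef_pos1 i c m l : covers i c m l -> pos1 (hall_coef [mset simple_root i]%mset m l).
Proof.
move=> cov; apply: pos1M; first exact: pos1_ssz.
rewrite (hall_poly_covers cov) rmorph_sum horner_sum.
have X1 j : pos1 (map_poly intr ('X^j : {poly int})).[rr / ss].
  by rewrite map_polyXn hornerXn; apply/pos1X/pos1M; [exact: pos1_rr | apply/pos1V/pos1_ss].
apply: (@pos1_sum _ _ _ (starts l i c.+1)) => [||j]; [|exact: X1|right; exact: X1].
by rewrite mem_index_iota leqnn (covers_starts_lt cov).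
Qed.

Lemma hall_coef_neq0 i m l : hall_coef [mset simple_root i]%mset m l != 0 ->
  exists c, covers i c m l.
Proof.
move=> nz; apply: hall_poly_neq0; apply: contraNneq nz => h0.
by rewrite /hall_coef h0 rmorph0 horner0 mulr0.
Qed.

Lemma hall_coef_nneg1 i m l : nneg1 (hall_coef [mset simple_root i]%mset m l).
Proof.
have [->|/hall_coef_neq0[c cov]] := eqVneq (hall_coef [mset simple_root i]%mset m l) 0.
  by left.
by right; apply: hall_coef_pos1 cov.
Qed.

(** Each [c] gives at most one [l], and [c] is bounded. The sum over all classes in [hall_mul_basis]
    takes the default value [0] when its support is infinite, so this has to be known. *)
Lemma finite_hall_coef i m :
  finite_set [set l | hall_coef [mset simple_root i]%mset m l != 0]%classic.
Proof.
pose f c := xget mset0 [set l | covers i c m l]%classic.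
apply: (@sub_finite_set _ _ (f @` `I_(i + \sum_(r <- m) (val r).2).+1)%classic).
  move=> l /hall_coef_neq0[c cov]; exists c; first by rewrite /= ltnS (covers_bound cov).
  by apply: xget_unique => // l'; move/covers_inj; apply.
exact/finite_image/finite_II.
Qed.

Lemma mcoeff_hall_sum (F : Lam -> Qrs) l : finite_set [set m | F m != 0]%classic ->
  (\sum_(m \in [set: Lam]) F m *: hall_basis m)@_l = F l.
Proof.
move=> /finite_fsetP[X eqX].
have XE m : (F m != 0) = (m \in X).
  by apply/idP/idP => [Fm | mX]; [have : [set` X]%classic m by rewrite -eqX |
    have : [set m | F m != 0]%classic m by rewrite eqX].
rewrite (@fsbigTE _ _ _ _ X) => [|m]; last first.
  by rewrite -XE negbK => /eqP->; rewrite scale0r.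
rewrite /hall_basis (raddf_sum (mcoeff l)).
under eq_bigr do rewrite /= mcoeffZ mcoeffU mulrnAr mulr1 mulrb.
have [lX | lX] := boolP (l \in X).
  rewrite (bigD1_seq l) ?fset_uniq //= eqxx big1 ?addr0 // => m /negPf.
  by rewrite eq_sym => ->.
rewrite big1_seq => [|m /= mX].
  by apply/esym/eqP; rewrite -[_ == _]negbK XE.
by case: eqP => // e; rewrite -e mX in lX.
Qed.

Lemma mcoeff_hall_mul i (y : Hall) l :
  (hall_mul (hall_basis [mset simple_root i]%mset) y)@_l =
  \sum_(m <- msupp y) y@_m * hall_coef [mset simple_root i]%mset m l.
Proof.
rewrite /hall_mul /hall_basis msuppU oner_eq0 big_seq_fset1 (raddf_sum (mcoeff l)).
apply: eq_bigr => m _; rewrite /= mcoeffZ mcoeffUU mul1r; congr (_ * _).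
exact: mcoeff_hall_sum (finite_hall_coef i m).
Qed.

Lemma u_word_coef (k : fieldType) w (G : rep k) l : is_word_ext w G -> rep_iso G (rep_Lam k l) ->
  [/\ forall m : Lam, nneg1 (u_word w)@_m, pos1 (u_word w)@_l &
      forall m : Lam, (u_word w)@_m != 0 -> forall a b, (a <= b)%N -> (rk m a b <= rk l a b)%N].
Proof.
elim: w G l => [|i w IHw] G l /=.
  move=> isoG0 isoG; have -> : l = mset0.
    apply: rk_inj => a b le_ab; have /rep_iso_LamP <- // := isoG.
    by rewrite (rank_path_iso isoG0) // enum_mset0; apply/eqP; rewrite -leqn0 rank_leq_row.
  rewrite /u_word /= /hall_basis; split=> [m||m].
  - by rewrite mcoeffU; case: eqP => _; [right; exact: pos1_1 | left].
  - by rewrite mcoeffUU; exact: pos1_1.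
  by rewrite mcoeffU; case: (mset0 =P m) => [<- // | _]; rewrite eqxx.
move=> [N wN extN] isoG; have [m isoN] := rep_Lam_exists N.
have [c cov c_max] := generic_ext_covers isoN isoG extN.
have [IH0 IHpos IHle] := IHw N m wN isoN.
split=> [l' | | l']; rewrite mcoeff_hall_mul.
- by apply: nneg1_sum => m' _; apply: nneg1M; [exact: IH0 | exact: hall_coef_nneg1].
(* The summand of the generic class [m] is positive, and the others cannot cancel it. *)
- apply: (@pos1_sum _ _ _ m) => [||m'].
  + by rewrite -mcoeff_neq0 pos1_neq0.
  + by apply: pos1M => //; apply: hall_coef_pos1 cov.
  by apply: nneg1M; [exact: IH0 | exact: hall_coef_nneg1].
(* A nonzero coefficient has a nonzero summand; its class [m'] lies below [m] by induction, and
   covering preserves this. *)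
move=> nz; have [m' m'_w] : exists2 m', (u_word w)@_m' != 0 &
    hall_coef [mset simple_root i]%mset m' l' != 0.
  apply: contrapT => none; move: nz; rewrite big1 ?eqxx // => m' _.
  apply/eqP; rewrite mulf_eq0; apply: contrapT => /negP; rewrite negb_or => /andP[w0 coef0].
  exact: none (ex_intro2 _ _ m' w0 coef0).
move=> /hall_coef_neq0[c' cov']; exact: covers_rk_le cov c_max cov' (IHle _ m'_w).
Qed.

End Coefficients.

(** * Triangularity *)

Section RankWeight.
Implicit Types (l m : Lam) (s : seq Defs.root).

(** The sum of [rk s a b] over all [a <= b]; summing root by root makes it finite without a bound on
    the vertices. *)
Definition rank_weight s : nat :=
  \sum_(r <- s) \sum_(a < (val r).2.+1) \sum_(b < (val r).2.+1) ((val r).1 <= a <= b)%N.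

Lemma rank_weightE s B : (forall r, r \in s -> ((val r).2 < B)%N) ->
  rank_weight s = (\sum_(a < B) \sum_(b < B | (a <= b)%N) rk s a b)%N.
Proof.
move=> sB; under [RHS]eq_bigr => a _ do under eq_bigr => b _ do
  rewrite /rk -sum1_count big_mkcond.
under [RHS]eq_bigr => a _ do rewrite exchange_big.
rewrite exchange_big; apply: eq_big_seq => r /sB rB /=.
rewrite (big_ord_widen B (fun a => (\sum_(b < (val r).2.+1) ((val r).1 <= a <= b))%N)) //.
rewrite big_mkcond; apply: eq_bigr => a _.
rewrite (big_ord_widen B (fun b => ((val r).1 <= a <= b)%N : nat)) //.
rewrite big_mkcond [RHS]big_mkcond /=.
case: (ltnP a _) => [lt_ar | le_ra]; last first.
  rewrite big1 // => b _; case: leqP => // le_ab.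
  by rewrite [(b <= _)%N]leqNgt (leq_trans le_ra le_ab) andbF.
by apply: eq_bigr => b _; rewrite ltnS; case: (_ <= b)%N; case: (b <= _)%N;
  rewrite ?andbT ?andbF //; case: (_ <= a)%N.
Qed.

Lemma rank_weight_lt l m : (forall a b, (a <= b)%N -> (rk m a b <= rk l a b)%N) -> m != l ->
  (rank_weight m < rank_weight l)%N.
Proof.
move=> le_ml ne_ml; pose B := (\sum_(r <- enum_mset l ++ enum_mset m) (val r).2).+1.
have in_B r : r \in enum_mset l ++ enum_mset m -> ((val r).2 < B)%N.
  by move=> rlm; rewrite /B ltnS (big_rem _ rlm) leq_addr.
have [a [b [le_ab lt_ml]]] : exists a b, (a <= b)%N /\ (rk m a b < rk l a b)%N.
  apply: contrapT => none; case/eqP: ne_ml; apply: rk_inj => a b le_ab.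
  apply/eqP; rewrite eqn_leq le_ml //= leqNgt; apply/negP=> lt_ml.
  by apply: none; exists a, b.
have lt_bB : (b < B)%N.
  have : (0 < rk l a b)%N by apply: leq_ltn_trans lt_ml.
  rewrite -has_count => /hasP[r rl /andP[_ le_br]]; apply: leq_ltn_trans le_br (in_B _ _).
  by rewrite mem_cat rl.
have lt_aB := leq_ltn_trans le_ab lt_bB.
rewrite !(@rank_weightE _ B) => [|r rl|r rm]; try by apply: in_B; rewrite mem_cat ?rl ?rm ?orbT.
rewrite (bigD1 (Ordinal lt_aB)) // [X in (_ < X)%N](bigD1 (Ordinal lt_aB)) //=.
rewrite -addSn leq_add //; last by apply: leq_sum => c _; apply: leq_sum => d; apply: le_ml.
rewrite (bigD1 (Ordinal lt_bB)) // [X in (_ < X)%N](bigD1 (Ordinal lt_bB)) //=.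
by rewrite -addSn leq_add // leq_sum // => d /andP[/le_ml].
Qed.

End RankWeight.

Lemma malg_expand (K : choiceType) (R : nzRingType) (x : {malg R[K]}) :
  x = \sum_(l <- msupp x) x@_l *: << l >>.
Proof.
rewrite {1}[x]monalgE; apply: eq_bigr => l _; apply/malgP => m.
by rewrite mcoeffZ !mcoeffU mulrnAr mulr1.
Qed.

(** * Triangular families in a free module *)

Section Triangularity.
Variables (K : choiceType) (F : fieldType) (S : set F) (v : K -> {malg F[K]}) (wt : K -> nat).
Implicit Types (l m : K) (c : {malg F[K]}).
Hypotheses (S0 : S 0) (S1 : S 1) (SN : forall x, S x -> S (- x))
  (SD : forall x y, S x -> S y -> S (x + y)) (SM : forall x y, S x -> S y -> S (x * y)).
Hypotheses (Sv : forall l m, S (v l)@_m) (Sv_unit : forall l, S ((v l)@_l)^-1)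
  (v_diag : forall l, (v l)@_l != 0)
  (v_low : forall l m, (v l)@_m != 0 -> m != l -> (wt m < wt l)%N).

Let comb c : {malg F[K]} := \sum_(l <- msupp c) c@_l *: v l.
Let span : set {malg F[K]} :=
  [set x | exists2 c : {malg F[K]}, (forall l, S c@_l) & x = comb c]%classic.

Let comb_widen (X : {fset K}) c : (msupp c `<=` X)%fset -> comb c = \sum_(l <- X) c@_l *: v l.
Proof.
move=> cX; rewrite /comb (big_fset_incl _ cX) // => l _ lc.
by rewrite mcoeff_outdom ?scale0r.
Qed.

Let span0 : span 0.
Proof. by exists 0 => [l|]; rewrite ?mcoeff0 // /comb msupp0 big_nil. Qed.

Let spanD x y : span x -> span y -> span (x + y).
Proof.
move=> [c Sc ->] [d Sd ->]; exists (c + d) => [l|]; first by rewrite mcoeffD; apply: SD.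
rewrite (comb_widen (msuppD_le c d)) (comb_widen (fsubsetUl _ (msupp d)))
  (comb_widen (fsubsetUr (msupp c) _)) -big_split.
by apply: eq_bigr => l _; rewrite mcoeffD scalerDl.
Qed.

Let spanZ a x : S a -> span x -> span (a *: x).
Proof.
move=> Sa [c Sc ->]; exists (a *: c) => [l|]; first by rewrite mcoeffZ; apply: SM.
rewrite (comb_widen (msuppZ_le a c)) scaler_sumr.
by apply: eq_bigr => l _; rewrite mcoeffZ scalerA.
Qed.

Let span_v l : span (v l).
Proof.
exists (<< l >>) => [m|].
  by rewrite mcoeffU; case: eqP.
by rewrite /comb msuppU oner_eq0 big_seq_fset1 mcoeffUU scale1r.
Qed.

Let span_sum (X : seq K) (P : pred K) (f : K -> {malg F[K]}) :
  (forall l, P l -> span (f l)) -> span (\sum_(l <- X | P l) f l).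
Proof. by move=> sF; apply: big_ind => //. Qed.

(** Solve the expansion of [v l] for [<< l >>]: the diagonal coefficient has its inverse in [S], and
    the other terms have smaller weight. *)
Let span_basis l : span (<< l >>).
Proof.
have [n] := ubnP (wt l); elim: n l => // n IHn l; rewrite ltnS => le_ln.
have lv : l \in msupp (v l) by rewrite -mcoeff_neq0.
have := malg_expand (v l); rewrite (bigD1_seq l) ?fset_uniq //= => vl.
have -> : << l >> = ((v l)@_l)^-1 *:
    (v l + (-1) *: \sum_(m <- msupp (v l) | m != l) (v l)@_m *: << m >>).
  by rewrite {2}vl scaleN1r addrK scalerA mulVf // scale1r.
apply: spanZ => //; apply: spanD => //; apply: spanZ; first exact: SN.
apply: span_sum => m ne_ml; have [-> | nz] := eqVneq (v l)@_m 0; first by rewrite scale0r.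
by apply: spanZ => //; apply: IHn; apply: leq_trans (v_low nz ne_ml) le_ln.
Qed.

Lemma triangular_gen x : (forall l, S x@_l) ->
  exists2 c : {malg F[K]}, (forall l, S c@_l) & x = \sum_(l <- msupp c) c@_l *: v l.
Proof.
move=> Sx; suff : span x by [].
by rewrite [x]malg_expand; apply: span_sum => l _; apply: spanZ.
Qed.

(** At an index of maximal weight in the support of [c], only the diagonal term contributes. *)
Lemma triangular_free c : \sum_(l <- msupp c) c@_l *: v l = 0 -> c = 0.
Proof.
move=> c0; apply/malgP => l0; rewrite mcoeff0; have [// | ] := eqVneq c@_l0 0.
rewrite mcoeff_neq0 => l0c; exfalso.
have [l lc l_max] : exists2 l, l \in msupp c &
    forall m, m \in msupp c -> (wt m <= wt l)%N.
  have [u _ u_max] := @arg_maxnP _ (FSetSub l0c) xpredT (fun u => wt (val u)) isT.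
  by exists (val u) => [|m mc]; [exact: valP | exact: (u_max (FSetSub mc))].
have := congr1 (mcoeff l) c0; rewrite mcoeff0 (raddf_sum (mcoeff l)).
rewrite (bigD1_seq l) ?fset_uniq //= big1_seq => [|m /andP[ne_ml mc]].
  rewrite addr0 mcoeffZ => /eqP; rewrite mulf_eq0 (negPf (v_diag l)) orbF.
  by apply/negP; rewrite mcoeff_neq0.
rewrite mcoeffZ; have [-> | nz] := eqVneq (v m)@_l 0; first by rewrite mulr0.
have := v_low nz; rewrite eq_sym => /(_ ne_ml); rewrite ltnNge => /negP[].
exact: l_max.
Qed.

End Triangularity.

(** * The localization and the two bases *)

Lemma Zrs_locP (x : Qrs) : Zrs_loc x <-> exists p q, ev1 q != 0 /\
  x = FracField.tofrac p / FracField.tofrac q.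
Proof.
by split=> -[p [q [q0 ->]]]; exists p, q; split=> //;
  [apply/eqP=> /in_idealP | move/in_idealP/eqP; apply/negP].
Qed.

Lemma Zrs_loc_pos1 (x : Qrs) : pos1 x -> Zrs_loc x.
Proof. by case=> p [q [_ q0 ->]]; apply/Zrs_locP; exists p, q; rewrite gt_eqF. Qed.

Lemma Zrs_loc0 : Zrs_loc 0.
Proof. by apply/Zrs_locP; exists 0, 1; rewrite tofrac0 mul0r /ev1 !hornerE. Qed.

Lemma Zrs_locN (x : Qrs) : Zrs_loc x -> Zrs_loc (- x).
Proof.
by case/Zrs_locP=> p [q [q0 ->]]; apply/Zrs_locP; exists (- p), q; rewrite tofracN mulNr.
Qed.

Lemma Zrs_locD (x y : Qrs) : Zrs_loc x -> Zrs_loc y -> Zrs_loc (x + y).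
Proof.
move=> /Zrs_locP[p [q [q0 ->]]] /Zrs_locP[p' [q' [q0' ->]]]; apply/Zrs_locP.
exists (p * q' + p' * q), (q * q'); rewrite ev1M mulf_neq0 //; split=> //.
by rewrite rmorphD !rmorphM addf_div // tofrac_ev1_neq0.
Qed.

Lemma Zrs_locM (x y : Qrs) : Zrs_loc x -> Zrs_loc y -> Zrs_loc (x * y).
Proof.
move=> /Zrs_locP[p [q [q0 ->]]] /Zrs_locP[p' [q' [q0' ->]]]; apply/Zrs_locP.
by exists (p * p'), (q * q'); rewrite ev1M mulf_neq0 //; split=> //; rewrite !rmorphM mulf_div.
Qed.

Theorem theorem4p4 (w : Lam -> word) (hw : forall l : Lam, word_class (w l) l) :
  is_basis_over setT setT (fun l : Lam => u_word (w l)) /\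
  ((forall l : Lam, distinguished (w l)) ->
   is_basis_over Zrs_loc (Hall_form Zrs_loc) (fun l : Lam => u_word (w l))).
Proof.
(* The coefficients of [u_word] do not involve [k], so a single algebraically closed field suffices
   to find their shape. *)
pose k : closedFieldType := algC.
have coef l := u_word_coef (hw l k) (rep_iso_refl _).
have diag (l : Lam) : (u_word (w l))@_l != 0 by have [_ /pos1_neq0] := coef l.
have low (l m : Lam) : (u_word (w l))@_m != 0 -> m != l -> (rank_weight m < rank_weight l)%N.
  by have [_ _ le_l] := coef l; move=> /le_l; apply: rank_weight_lt.
have free := triangular_free diag low.
split=> [|_].
  by split=> // [x _ | c _]; [apply: triangular_gen diag low _ _ | exact: free].
split=> [l m | x Sx | c _]; last exact: free.
  by have [/(_ m)[-> | /Zrs_loc_pos1 //] _ _] := coef l; apply: Zrs_loc0.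
apply: triangular_gen diag low _ Sx => [|||||l m|l].
- exact: Zrs_loc0.
- exact: Zrs_loc_pos1 pos1_1.
- exact: Zrs_locN.
- exact: Zrs_locD.
- exact: Zrs_locM.
- by have [/(_ m)[-> | /Zrs_loc_pos1 //] _ _] := coef l; apply: Zrs_loc0.
(* The diagonal coefficient is positive at [r = s = 1], and so is its inverse. *)
by have [_ /pos1V/Zrs_loc_pos1] := coef l.
Qed.
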